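(* Let $\mu\in\mathbb{C}$ with $\mu\neq-1,-2,-3,\ldots$ and let $\ell\in\mathbb{N}_0$. For every $j\in\mathbb{N}_0$ the polynomial $M_j^{\mu,\ell}(x)$ is a solution on $\mathbb{R}_+$ of the fourth order differential equation $$\mathcal{P}_{\mu,\ell}u=j(j+\mu+1)u.$$ Moreover, if $\mu$ is real with $\mu\geq2\ell+1$, then, up to scalar multiples, $M_j^{\mu,\ell}$ is the unique polynomial solution of this equation.
   Context: Let $I_\alpha$, $K_\alpha$ be the modified Bessel functions and set $\widetilde I_\alpha(z)=(z/2)^{-\alpha}I_\alpha(z)$, $\widetilde K_\alpha(z)=(z/2)^{-\alpha}K_\alpha(z)$. For $\mu\in\mathbb{C}$, $\ell\in\mathbb{N}_0$, $x>0$ and $t$ near $0$ define $$G^{\mu,\ell}(t,x)=\frac{1}{(1-t)^{\ell+\frac{\mu+3}{2}}}\left(\frac x2\right)^{2\ell+1}e^{\frac x2}\,\widetilde I_{\frac\mu2}\!\left(\frac{tx}{2(1-t)}\right)\widetilde K_{\ell+\frac12}\!\left(\frac{x}{2(1-t)}\right),$$ and $M_j^{\mu,\ell}(x)=\frac{\Gamma(j+\mu+1)}{j!\,2^\mu\,\Gamma(j+\frac{\mu+1}{2})}\left.\frac{\partial^j}{\partial t^j}\right|_{t=0}G^{\mu,\ell}(t,x)$ (a polynomial in $x$). Let $\theta=x\frac{d}{dx}$ be the Euler operator and define the operator on $\mathbb{R}_+$ $$\mathcal{P}_{\mu,\ell}=\frac{1}{x^2}\Big(\big(\theta+\mu-2\ell-1-\tfrac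 x2\big)\big(\theta+\mu-\tfrac x2\big)-\big(\tfrac x2\big)^2\Big)\Big(\big(\theta-2\ell-1-\tfrac x2\big)\big(\theta-\tfrac x2\big)-\big(\tfrac x2\big)^2\Big),$$ where products denote composition of operators and $x/2$, $(x/2)^2$ act by multiplication. *)

(* Defs.v *)
From Stdlib Require Import Reals List Factorial.
From Coquelicot Require Import Coquelicot.
Open Scope R_scope.

Definition Cpow_pos (y : R) (a : C) : C :=
  (exp (Re a * ln y) * cos (Im a * ln y), exp (Re a * ln y) * sin (Im a * ln y)).

Definition CDerive (f : R -> C) (x : R) : C :=
  (Derive (fun y => fst (f y)) x, Derive (fun y => snd (f y)) x).

Fixpoint CDerive_n (n : nat) (f : R -> C) : R -> C :=
  match n with
  | O => f
  | S m => CDerive (CDerive_n m f)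
  end.

(* ---------- reciprocal Gamma function (Euler's limit formula) ----------
   1/Gamma(z) = lim_n  z (z+1) ... (z+n) / (n! n^z),   valid for all z in C;
   it is entire, vanishing exactly at z = 0, -1, -2, ... *)
Fixpoint Cpoch (z : C) (n : nat) : C :=
  match n with
  | O => z
  | S m => Cmult (Cpoch z m) (Cplus z (RtoC (INR (S m))))
  end.

Definition rgamma_seq (z : C) (n : nat) : C :=
  Cdiv (Cpoch z n) (Cmult (RtoC (INR (fact n))) (Cpow_pos (INR n) z)).

Definition Crgamma (z : C) : C :=
  (real (Lim_seq (fun n => fst (rgamma_seq z n))),
   real (Lim_seq (fun n => snd (rgamma_seq z n)))).

Definition Rrgamma (x : R) : R := fst (Crgamma (RtoC x)).

(* Itilde_alpha(z) = (z/2)^(-alpha) I_alpha(z)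
                   = sum_k (z/2)^(2k) / (k! Gamma(k+alpha+1)),
   the entire function of z (here for real z, complex order alpha). *)
Definition Itilde (alpha : C) (z : R) : C :=
  (Series (fun k => (z/2) ^ (2*k) / INR (fact k) *
                    fst (Crgamma (Cplus alpha (RtoC (INR k + 1))))),
   Series (fun k => (z/2) ^ (2*k) / INR (fact k) *
                    snd (Crgamma (Cplus alpha (RtoC (INR k + 1)))))).

Definition BesselI (nu z : R) : R :=
  Series (fun k => Rpower (z/2) (2 * INR k + nu) / INR (fact k) *
                   Rrgamma (INR k + nu + 1)).

(* K_nu(z) = pi/2 (I_{-nu}(z) - I_nu(z)) / sin(nu pi), for non-integer real nu
   (we only use nu = l + 1/2) and z > 0 *)
Definition BesselK (nu z : R) : R :=
  PI / 2 * (BesselI (- nu) z - BesselI nu z) / sin (nu * PI).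

Definition Ktilde (nu z : R) : R := Rpower (z/2) (- nu) * BesselK nu z.

Definition G (mu : C) (l : nat) (t x : R) : C :=
  Cmult (Cpow_pos (1 - t) (Copp (Cplus (RtoC (INR l)) (Cdiv (Cplus mu (RtoC 3)) (RtoC 2)))))
  (Cmult (RtoC ((x/2) ^ (2*l+1) * exp (x/2)))
  (Cmult (Itilde (Cdiv mu (RtoC 2)) (t * x / (2 * (1 - t))))
         (RtoC (Ktilde (INR l + /2) (x / (2 * (1 - t))))))).

(* Gamma(j+mu+1) / (j! 2^mu Gamma(j+(mu+1)/2))
   = (1/Gamma)(j+(mu+1)/2) / (j! 2^mu (1/Gamma)(j+mu+1)) *)
Definition Mcoef (mu : C) (j : nat) : C :=
  Cdiv (Crgamma (Cplus (RtoC (INR j)) (Cdiv (Cplus mu (RtoC 1)) (RtoC 2))))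
       (Cmult (Cmult (RtoC (INR (fact j))) (Cpow_pos 2 mu))
              (Crgamma (Cplus (RtoC (INR j)) (Cplus mu (RtoC 1))))).

Definition M (mu : C) (l j : nat) (x : R) : C :=
  Cmult (Mcoef mu j) (CDerive_n j (fun t => G mu l t x) 0).

Definition theta (f : R -> C) : R -> C := fun x => Cmult (RtoC x) (CDerive f x).

Definition Lfac (a : C) (f : R -> C) : R -> C :=
  fun x => Cplus (theta f x) (Cmult (Cminus a (RtoC (x/2))) (f x)).

Definition Lop (a b : C) (f : R -> C) : R -> C :=
  fun x => Cminus (Lfac a (Lfac b f) x) (Cmult (RtoC ((x/2)^2)) (f x)).

Definition Pop (mu : C) (l : nat) (u : R -> C) : R -> C :=
  fun x => Cmult (RtoC (/ x^2))
    (Lop (Cminus mu (RtoC (2 * INR l + 1))) mu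
         (Lop (RtoC (- (2 * INR l + 1))) (RtoC 0) u) x).

Definition Cpoly_eval (cs : list C) (x : R) : C :=
  fold_right (fun c acc => Cplus c (Cmult (RtoC x) acc)) (RtoC 0) cs.

(* Main.v *)
(* With [v = x/(2(1-t))] and [w = t v], so that [x/2 = v - w], the generating function becomes
   [G = const * (1-t)^(l-(mu+1)/2) * h(w) * p(v)], where [h(w) = exp(-w) Itilde(w)] and
   [p(v) = exp(v) (v/2)^(2l+1) Ktilde(v)] is, up to a constant, a polynomial of degree [l].  The
   Taylor coefficients of [h] and [p] satisfy two-term recursions (Kummer's equation), which gives
   [M_j] as an explicit double sum.  On monomials, [P] maps [x^n] to a combination of [x^(n-2)],
   [x^(n-1)] and [x^n], so the eigenvalue equation is a three-term relation between coefficients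
   in [x], and after expanding every power of [1-t] in the same binomial series it reduces, term by
   term, to a polynomial identity modulo the recursions of [h] and [p].  For uniqueness, the
   leading coefficient of a polynomial solution forces its degree to be [j+l], and the coefficient
   of [x^(j+l)] in [M_j] is a nonzero multiple of [h_j p_l]. *)
Require Import Defs.
From Stdlib Require Import Reals List Lra Lia ZArith.
From Coquelicot Require Import Coquelicot.

(** * Componentwise complex limits and derivatives *)

(** The overview leaves out the analytic obstacles. [Lim_seq], [Series] and [Derive] return default
    values where a limit is missing, so Euler's limit must be shown to converge for every complex
    [z] before [1/Gamma(z) = z / Gamma(z+1)] can be used; this functional equation links the Bessel
    series to their coefficient recursions. All recursions are kept multiplied out, so that they
    hold for every complex [mu], without division by a factor that might vanish. The difference of
    [I_(-nu)] and [I_nu] that defines [K_nu] at [nu = l + 1/2] turns out to be one entire series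
    split by parity, and that series is [exp (-z)] times a polynomial. The other factor [h] is not a
    polynomial; its derivatives in [t] are computed inside a family of functions stable under
    [d/dt], which gives them in closed form at [t = 0]. Nonvanishing of the leading coefficient of
    [M_j] rests on [1/Gamma(x) <> 0] for [x > 0], which comes from a lower bound on Euler's partial
    products. *)

Lemma C_ext (a b : C) : fst a = fst b -> snd a = snd b -> a = b.
Proof. destruct a, b; simpl; intros; subst; reflexivity. Qed.

Lemma RtoC_fst_snd (z : C) : snd z = 0 -> z = RtoC (fst z).
Proof. intros H; apply C_ext; simpl; auto. Qed.

Lemma RtoC_neq0 (r : R) : r <> 0 -> RtoC r <> RtoC 0.
Proof. intros H E; apply H; injection E; auto. Qed.

Lemma Cmult_integral_r (a b : C) : Cmult a b = RtoC 0 -> a <> RtoC 0 -> b = RtoC 0.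
Proof.
  intros E Ha.
  replace b with (Cmult (Cinv a) (Cmult a b)) by (field; exact Ha).
  rewrite E; ring.
Qed.

Lemma snd_le_Cmod (c : C) : Rabs (snd c) <= Cmod c.
Proof. eapply Rle_trans; [apply Rmax_r | apply Rmax_Cmod]. Qed.

Lemma fst_le_Cmod (c : C) : Rabs (fst c) <= Cmod c.
Proof. eapply Rle_trans; [apply Rmax_l | apply Rmax_Cmod]. Qed.

Definition is_Clim (u : nat -> C) (l : C) : Prop :=
  is_lim_seq (fun n => fst (u n)) (fst l) /\ is_lim_seq (fun n => snd (u n)) (snd l).

Lemma is_Clim_unique (u : nat -> C) (l l' : C) : is_Clim u l -> is_Clim u l' -> l = l'.
Proof.
  intros [A B] [A' B']; apply C_ext.
  - apply is_lim_seq_unique in A; apply is_lim_seq_unique in A'.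
    rewrite A in A'; injection A'; auto.
  - apply is_lim_seq_unique in B; apply is_lim_seq_unique in B'.
    rewrite B in B'; injection B'; auto.
Qed.

Lemma is_Clim_ext_loc (u v : nat -> C) (l : C) :
  eventually (fun n => u n = v n) -> is_Clim u l -> is_Clim v l.
Proof.
  intros [N H] [A B]; split.
  - apply is_lim_seq_ext_loc with (2 := A); exists N; intros n Hn; now rewrite H.
  - apply is_lim_seq_ext_loc with (2 := B); exists N; intros n Hn; now rewrite H.
Qed.

Lemma is_Clim_const (c : C) : is_Clim (fun _ => c) c.
Proof. split; apply is_lim_seq_const. Qed.

Lemma is_Clim_mult (u v : nat -> C) (a b : C) :
  is_Clim u a -> is_Clim v b -> is_Clim (fun n => Cmult (u n) (v n)) (Cmult a b).
Proof.
  intros [A B] [A' B']; split; simpl.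
  - apply is_lim_seq_minus'; apply is_lim_seq_mult'; auto.
  - apply is_lim_seq_plus'; apply is_lim_seq_mult'; auto.
Qed.

Definition is_Cder (f : R -> C) (x : R) (l : C) : Prop :=
  is_derive (fun y => fst (f y)) x (fst l) /\ is_derive (fun y => snd (f y)) x (snd l).

Lemma is_Cder_CDerive (f : R -> C) (x : R) (l : C) : is_Cder f x l -> CDerive f x = l.
Proof. intros [A B]; apply C_ext; simpl; now apply is_derive_unique. Qed.

Lemma CDerive_ext_loc (f g : R -> C) (x : R) :
  locally x (fun y => f y = g y) -> CDerive f x = CDerive g x.
Proof.
  intros H; unfold CDerive; f_equal; apply Derive_ext_loc;
    apply filter_imp with (2 := H); intros y E; now rewrite E.
Qed.

Lemma is_Cder_const (c : C) (x : R) : is_Cder (fun _ => c) x (RtoC 0).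
Proof. split; apply (is_derive_const (K := R_AbsRing) (V := R_NormedModule)). Qed.

Lemma is_Cder_plus (f g : R -> C) (x : R) (a b : C) :
  is_Cder f x a -> is_Cder g x b -> is_Cder (fun y => Cplus (f y) (g y)) x (Cplus a b).
Proof.
  intros [A B] [A' B']; split; simpl;
    apply (is_derive_plus (K := R_AbsRing) (V := R_NormedModule)); auto.
Qed.

Lemma is_Cder_mult (f g : R -> C) (x : R) (a b : C) :
  is_Cder f x a -> is_Cder g x b ->
  is_Cder (fun y => Cmult (f y) (g y)) x (Cplus (Cmult a (g x)) (Cmult (f x) b)).
Proof.
  intros [A B] [A' B']; split; simpl.
  - evar_last.
    { apply (is_derive_minus (K := R_AbsRing) (V := R_NormedModule));
      apply (is_derive_mult (K := R_AbsRing)); eauto; intros; apply Rmult_comm. }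
    unfold minus, plus, opp, mult; simpl; ring.
  - evar_last.
    { apply (is_derive_plus (K := R_AbsRing) (V := R_NormedModule));
      apply (is_derive_mult (K := R_AbsRing)); eauto; intros; apply Rmult_comm. }
    unfold plus, mult; simpl; ring.
Qed.

Lemma is_Cder_scal (c : C) (f : R -> C) (x : R) (a : C) :
  is_Cder f x a -> is_Cder (fun y => Cmult c (f y)) x (Cmult c a).
Proof.
  intros H; replace (Cmult c a) with (Cplus (Cmult (RtoC 0) (f x)) (Cmult c a)) by ring.
  apply (is_Cder_mult (fun _ => c)); [apply is_Cder_const | exact H].
Qed.

Lemma is_Cder_RtoC (f : R -> R) (x l : R) :
  is_derive f x l -> is_Cder (fun y => RtoC (f y)) x (RtoC l).
Proof.
  intros H; split; simpl; [exact H |].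
  apply (is_derive_const (K := R_AbsRing) (V := R_NormedModule)).
Qed.

Lemma is_Cder_comp (f : R -> C) (g : R -> R) (x d : R) (a : C) :
  is_derive g x d -> is_Cder f (g x) a ->
  is_Cder (fun y => f (g y)) x (Cmult (RtoC d) a).
Proof.
  intros Hg [A B]; split; simpl.
  - evar_last.
    { apply (is_derive_comp (fun y => fst (f y)) g); eauto. }
    change (d * fst a = d * fst a - 0 * snd a); ring.
  - evar_last.
    { apply (is_derive_comp (fun y => snd (f y)) g); eauto. }
    change (d * snd a = d * snd a + 0 * fst a); ring.
Qed.

(** * Complex powers of positive reals *)

Lemma Cpow_pos_plus (y : R) (a b : C) :
  Cpow_pos y (Cplus a b) = Cmult (Cpow_pos y a) (Cpow_pos y b).
Proof.
  unfold Cpow_pos, Cplus, Cmult, Re, Im; simpl.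
  rewrite !Rmult_plus_distr_r, exp_plus, cos_plus, sin_plus; f_equal; ring.
Qed.

Lemma Cpow_pos_mult_base (x y : R) (a : C) : 0 < x -> 0 < y ->
  Cpow_pos (x * y) a = Cmult (Cpow_pos x a) (Cpow_pos y a).
Proof.
  intros Hx Hy; unfold Cpow_pos, Cmult; simpl; rewrite ln_mult by auto.
  rewrite !Rmult_plus_distr_l, exp_plus, cos_plus, sin_plus; f_equal; ring.
Qed.

Lemma Cpow_pos_RtoC (y r : R) : Cpow_pos y (RtoC r) = RtoC (Rpower y r).
Proof.
  unfold Cpow_pos, Rpower, RtoC; simpl; rewrite Rmult_0_l, cos_0, sin_0; f_equal; ring.
Qed.

Lemma Cpow_pos_one (y : R) : 0 < y -> Cpow_pos y (RtoC 1) = RtoC y.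
Proof. intros H; rewrite Cpow_pos_RtoC, Rpower_1; auto. Qed.

Lemma Cpow_pos_1 (a : C) : Cpow_pos 1 a = RtoC 1.
Proof.
  unfold Cpow_pos, RtoC; rewrite ln_1, !Rmult_0_r, exp_0, cos_0, sin_0; f_equal; ring.
Qed.

Lemma Cmod_Cpow_pos (y : R) (a : C) : Cmod (Cpow_pos y a) = exp (Re a * ln y).
Proof.
  unfold Cmod, Cpow_pos; simpl.
  set (e := exp _); set (c := cos _) in *; set (s := sin _).
  replace (e * c * (e * c * 1) + e * s * (e * s * 1)) with (Rsqr e * (Rsqr s + Rsqr c))
    by (unfold Rsqr; ring).
  unfold s, c; rewrite sin2_cos2, Rmult_1_r.
  apply sqrt_Rsqr, Rlt_le, exp_pos.
Qed.

Lemma Cpow_pos_neq0 (y : R) (a : C) : Cpow_pos y a <> RtoC 0.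
Proof. apply Cmod_gt_0; rewrite Cmod_Cpow_pos; apply exp_pos. Qed.

Lemma Cpow_pos_nat_mult (y : R) (n : nat) (a : C) : 0 < y ->
  Cmult (RtoC (y ^ n)) (Cpow_pos y a) = Cpow_pos y (Cplus a (RtoC (INR n))).
Proof.
  intros Hy; rewrite Cpow_pos_plus, Cpow_pos_RtoC, Rpower_pow by auto; ring.
Qed.

Lemma is_Cder_Cpow_pos (a : C) (t : R) : t < 1 ->
  is_Cder (fun s => Cpow_pos (1 - s) a) t
    (Cmult (Copp a) (Cpow_pos (1 - t) (Cminus a (RtoC 1)))).
Proof.
  intros Ht.
  assert (E : Cpow_pos (1 - t) a =
              Cmult (Cpow_pos (1 - t) (Cminus a (RtoC 1))) (RtoC (1 - t))).
  { rewrite <- (Cpow_pos_one (1 - t)) by lra.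
    rewrite <- Cpow_pos_plus; f_equal; ring. }
  assert (E' : Cpow_pos (1 - t) (Cminus a (RtoC 1)) =
               Cmult (RtoC (/ (1 - t))) (Cpow_pos (1 - t) a)).
  { rewrite E, RtoC_inv by lra; field; apply RtoC_neq0; lra. }
  rewrite E'; unfold Cpow_pos, Re, Im; split; simpl; auto_derive; try lra;
    unfold Rminus; field; lra.
Qed.

(** * The reciprocal Gamma function *)

(** At [s = 1/n] this is the ratio of the terms [n] and [n-1] of [rgamma_seq z]; as a function of a
    real variable [s] it can be estimated near 0 by its derivative. *)
Definition gfac (z : C) (s : R) : C :=
  Cmult (Cplus (RtoC 1) (Cmult z (RtoC s))) (Cpow_pos (1 - s) z).

(* The derivative vanishes to first order at 0, so the Euler product converges like [sum 1/n^2]. *)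
Lemma is_Cder_gfac (z : C) (s : R) : s < 1 ->
  is_Cder (gfac z) s
    (Cmult (RtoC s) (Cmult (Copp (Cmult z (Cplus (RtoC 1) z)))
                           (Cpow_pos (1 - s) (Cminus z (RtoC 1))))).
Proof.
  intros Hs.
  assert (E : Cpow_pos (1 - s) z =
              Cmult (Cpow_pos (1 - s) (Cminus z (RtoC 1))) (RtoC (1 - s))).
  { rewrite <- (Cpow_pos_one (1 - s)) by lra.
    rewrite <- Cpow_pos_plus; f_equal; ring. }
  assert (D : is_Cder (fun y => Cplus (RtoC 1) (Cmult z (RtoC y))) s (Cplus (RtoC 0) (Cmult z (RtoC 1)))).
  { apply is_Cder_plus; [apply is_Cder_const |].
    apply is_Cder_scal, is_Cder_RtoC; auto_derive; auto. }
  generalize (is_Cder_mult _ _ _ _ _ D (is_Cder_Cpow_pos z s Hs)); intros H.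
  eapply eq_rect; [exact H |].
  rewrite E, RtoC_minus; ring.
Qed.

Lemma gfac_bound (z : C) : exists B, 0 <= B /\
  forall s, 0 <= s <= 1 / 2 -> Cmod (Cminus (gfac z s) (RtoC 1)) <= B * s ^ 2.
Proof.
  (* For [s <= 1/2] the logarithm of [1 - s] lies between [- ln 2] and 0, which bounds the modulus
     of the power [z - 1] uniformly. *)
  set (A := Cmod (Cmult z (Cplus (RtoC 1) z)) * exp (Rabs (Re z - 1) * ln 2)).
  assert (HA : 0 <= A).
  { apply Rmult_le_pos; [apply Cmod_ge_0 | apply Rlt_le, exp_pos]. }
  assert (Hd : forall s, 0 <= s <= 1 / 2 ->
    Cmod (Cmult (RtoC s) (Cmult (Copp (Cmult z (Cplus (RtoC 1) z)))
                           (Cpow_pos (1 - s) (Cminus z (RtoC 1))))) <= A * s).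
  { intros s Hs; rewrite !Cmod_mult, Cmod_opp, Cmod_R, Rabs_pos_eq, Cmod_Cpow_pos by lra.
    rewrite Rmult_comm; apply Rmult_le_compat_r; [lra |].
    unfold A; rewrite Cmod_mult; apply Rmult_le_compat_l.
    { apply Rmult_le_pos; apply Cmod_ge_0. }
    assert (L : ln (1 - s) <= 0).
    { rewrite <- ln_1; apply ln_le; lra. }
    assert (L2 : - ln 2 <= ln (1 - s)).
    { rewrite <- ln_Rinv by lra; apply ln_le; lra. }
    destruct (Rle_lt_or_eq_dec (Re (Cminus z (RtoC 1)) * ln (1 - s)) (Rabs (Re z - 1) * ln 2)).
    - assert (E : Re (Cminus z (RtoC 1)) = Re z - 1) by (unfold Re; simpl; ring).
      rewrite E; apply Rle_trans with (Rabs ((Re z - 1) * ln (1 - s))); [apply Rle_abs |].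
      rewrite Rabs_mult; apply Rmult_le_compat_l; [apply Rabs_pos |].
      rewrite Rabs_left1; lra.
    - apply Rlt_le, exp_increasing; auto.
    - apply Req_le; f_equal; auto. }
  assert (H0 : gfac z 0 = RtoC 1).
  { unfold gfac; rewrite Rminus_0_r, Cpow_pos_1; ring. }
  assert (Hc : forall (p : C -> R), (p = fst \/ p = snd) ->
     forall s, 0 <= s <= 1 / 2 -> Rabs (p (gfac z s) - p (RtoC 1)) <= A * s ^ 2).
  { intros p Hp s Hs.
    destruct (MVT_gen (fun y => p (gfac z y)) 0 s
      (fun s => p (Cmult (RtoC s) (Cmult (Copp (Cmult z (Cplus (RtoC 1) z)))
                           (Cpow_pos (1 - s) (Cminus z (RtoC 1))))))) as [c [Hc E]].
    - intros x Hx; rewrite Rmin_left, Rmax_right in Hx by lra.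
      destruct (is_Cder_gfac z x ltac:(lra)); destruct Hp; subst p; auto.
    - intros x Hx; rewrite Rmin_left, Rmax_right in Hx by lra.
      apply continuity_pt_filterlim.
      apply (ex_derive_continuous (K := R_AbsRing) (V := R_NormedModule) (fun y => p (gfac z y))).
      destruct (is_Cder_gfac z x ltac:(lra)); destruct Hp; subst p; eexists; eauto.
    - rewrite Rmin_left, Rmax_right in Hc by lra.
      rewrite <- H0 at 1; rewrite E, Rabs_mult, Rminus_0_r, (Rabs_pos_eq s) by lra.
      replace (A * s ^ 2) with ((A * s) * s) by ring.
      apply Rmult_le_compat_r; [lra |].
      apply Rle_trans with (A * c); [| apply Rmult_le_compat_l; lra].
      eapply Rle_trans; [| apply Hd; lra].
      destruct Hp; subst p; [apply fst_le_Cmod | apply snd_le_Cmod]. }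
  exists (sqrt 2 * A); split.
  { apply Rmult_le_pos; [apply sqrt_pos | auto]. }
  intros s Hs; eapply Rle_trans; [apply Cmod_2Rmax |].
  rewrite Rmult_assoc; apply Rmult_le_compat_l; [apply sqrt_pos |].
  apply Rmax_lub.
  - apply (Hc fst); auto.
  - generalize (Hc snd (or_intror eq_refl) s Hs); simpl; auto.
Qed.

Lemma INR_S_pos (n : nat) : 0 < INR (S n).
Proof. apply lt_0_INR; lia. Qed.

Lemma INR_fact_pos (n : nat) : 0 < INR (fact n).
Proof. apply lt_0_INR, lt_O_fact. Qed.

(** The recursion starts at index 1, since the term of index 0 contains a power of 0. *)
Lemma rgamma_seq_step (z : C) (n : nat) :
  rgamma_seq z (S (S n)) = Cmult (rgamma_seq z (S n)) (gfac z (/ INR (S (S n)))).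
Proof.
  assert (Hn := INR_S_pos n); assert (Hn2 := INR_S_pos (S n)).
  assert (E : 1 - / INR (S (S n)) = INR (S n) * / INR (S (S n))).
  { rewrite (S_INR (S n)); field; rewrite <- S_INR; lra. }
  assert (E' : Cpow_pos (INR (S n)) z =
               Cmult (Cpow_pos (1 - / INR (S (S n))) z) (Cpow_pos (INR (S (S n))) z)).
  { rewrite <- Cpow_pos_mult_base; [f_equal; rewrite E; field; lra | | auto].
    rewrite E; apply Rmult_lt_0_compat; auto; apply Rinv_0_lt_compat; auto. }
  unfold rgamma_seq, gfac.
  change (Cpoch z (S (S n))) with (Cmult (Cpoch z (S n)) (Cplus z (RtoC (INR (S (S n)))))).
  rewrite E'.
  change (fact (S (S n))) with (S (S n) * fact (S n))%nat.
  rewrite mult_INR, RtoC_mult, RtoC_inv by lra.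
  assert (N1 : RtoC (INR (fact (S n))) <> RtoC 0) by (apply RtoC_neq0; generalize (INR_fact_pos (S n)); lra).
  assert (N2 : RtoC (INR (S (S n))) <> RtoC 0) by (apply RtoC_neq0; lra).
  field; repeat split; auto; apply Cpow_pos_neq0.
Qed.

(** A telescoping majorant of [1/n^2]: it gives the bounds on the product and on its increments in
    closed form. *)
Lemma inv_sq_le (n : nat) : (/ INR (S (S n))) ^ 2 <= / INR (S n) - / INR (S (S n)).
Proof.
  assert (Hn := INR_S_pos n); assert (Hn2 := INR_S_pos (S n)).
  assert (E : / INR (S n) - / INR (S (S n)) = / INR (S n) * / INR (S (S n))).
  { rewrite (S_INR (S n)); field; rewrite <- S_INR; lra. }
  rewrite E, <- Rsqr_pow2; apply Rmult_le_compat_r.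
  - apply Rlt_le, Rinv_0_lt_compat; auto.
  - apply Rinv_le_contravar; auto; apply le_INR; lia.
Qed.

Lemma rgamma_seq_increment (z : C) : exists K, 0 <= K /\ forall n,
  Cmod (rgamma_seq z (S n)) <= K /\
  Cmod (Cminus (rgamma_seq z (S (S n))) (rgamma_seq z (S n)))
    <= K * (/ INR (S n) - / INR (S (S n))).
Proof.
  destruct (gfac_bound z) as [B [HB Hg]].
  set (r1 := Cmod (rgamma_seq z 1)).
  assert (Hr1 : 0 <= r1) by apply Cmod_ge_0.
  assert (Hs : forall n, Cmod (Cminus (gfac z (/ INR (S (S n)))) (RtoC 1))
                         <= B * (/ INR (S n) - / INR (S (S n)))).
  { intros n; eapply Rle_trans; [apply Hg | apply Rmult_le_compat_l; auto; apply inv_sq_le].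
    split; [apply Rlt_le, Rinv_0_lt_compat, INR_S_pos |].
    unfold Rdiv; rewrite Rmult_1_l; apply Rinv_le_contravar; [lra |].
    rewrite !S_INR; generalize (pos_INR n); lra. }
  (* Each factor has modulus at most [1 + u <= exp u], and the exponents telescope. *)
  assert (Hb : forall n, Cmod (rgamma_seq z (S n)) <= r1 * exp (B * (1 - / INR (S n)))).
  { induction n.
    - simpl INR; rewrite Rinv_1; replace (B * (1 - 1)) with 0 by ring.
      rewrite exp_0, Rmult_1_r; apply Rle_refl.
    - rewrite rgamma_seq_step, Cmod_mult.
      replace (B * (1 - / INR (S (S n)))) with
        (B * (1 - / INR (S n)) + B * (/ INR (S n) - / INR (S (S n)))) by ring.
      rewrite exp_plus, <- Rmult_assoc.
      apply Rmult_le_compat; try apply Cmod_ge_0; auto.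
      eapply Rle_trans; [| apply exp_ineq1_le].
      replace (gfac z (/ INR (S (S n)))) with
        (Cplus (RtoC 1) (Cminus (gfac z (/ INR (S (S n)))) (RtoC 1))) by ring.
      eapply Rle_trans; [apply Cmod_triangle |].
      rewrite Cmod_1; apply Rplus_le_compat_l, Hs. }
  set (K := r1 * exp B).
  assert (HK : forall n, Cmod (rgamma_seq z (S n)) <= K).
  { intros n; eapply Rle_trans; [apply Hb |]; apply Rmult_le_compat_l; auto.
    assert (H : B * (1 - / INR (S n)) <= B).
    { rewrite <- (Rmult_1_r B) at 2; apply Rmult_le_compat_l; auto.
      generalize (Rinv_0_lt_compat _ (INR_S_pos n)); lra. }
    destruct H as [H | H]; [apply Rlt_le, exp_increasing; auto | rewrite H; apply Rle_refl]. }
  assert (K0 : 0 <= K) by (eapply Rle_trans; [apply Cmod_ge_0 | apply (HK O)]).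
  (* One constant serves both bounds: the terms need [K], the increments [K * B]. *)
  exists (K * (1 + B)); split; [apply Rmult_le_pos; lra |]; intros n; split.
  - eapply Rle_trans; [apply HK |]; rewrite <- (Rmult_1_r K) at 1.
    apply Rmult_le_compat_l; lra.
  - rewrite rgamma_seq_step.
    replace (Cminus (Cmult (rgamma_seq z (S n)) (gfac z (/ INR (S (S n))))) (rgamma_seq z (S n)))
      with (Cmult (rgamma_seq z (S n)) (Cminus (gfac z (/ INR (S (S n)))) (RtoC 1))) by ring.
    rewrite Cmod_mult, Rmult_assoc.
    apply Rmult_le_compat; try apply Cmod_ge_0; auto.
    eapply Rle_trans; [apply Hs |]; apply Rmult_le_compat_r; [| lra].
    generalize (inv_sq_le n) (pow2_ge_0 (/ INR (S (S n)))); lra.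
Qed.

(** Subtracting [K / n] makes the sequence nondecreasing while it stays bounded, so monotone
    convergence applies. *)
Lemma ex_lim_seq_small_increments (f : nat -> R) (K : R) :
  (forall n, Rabs (f (S n)) <= K) ->
  (forall n, Rabs (f (S (S n)) - f (S n)) <= K * (/ INR (S n) - / INR (S (S n)))) ->
  ex_finite_lim_seq f.
Proof.
  intros Hb Hi.
  assert (K0 : 0 <= K) by (eapply Rle_trans; [apply Rabs_pos | apply (Hb O)]).
  assert (H : ex_finite_lim_seq (fun n => f (S n) - K * / INR (S n))).
  { apply ex_finite_lim_seq_incr with K.
    - intros n; generalize (Hi n); intros H; apply Rabs_le_between in H; lra.
    - intros n; generalize (Hb n); intros H; apply Rabs_le_between in H.
      assert (0 <= K * / INR (S n)).
      { apply Rmult_le_pos; auto; apply Rlt_le, Rinv_0_lt_compat, INR_S_pos. }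
      lra. }
  destruct H as [l H]; exists (l + K * 0); apply is_lim_seq_incr_1.
  apply is_lim_seq_ext with (fun n => (f (S n) - K * / INR (S n)) + K * / INR (S n)).
  { intros n; ring. }
  apply is_lim_seq_plus'; auto.
  apply (is_lim_seq_scal_l _ K (Finite 0)).
  apply (is_lim_seq_incr_1 (fun n => / INR n)).
  apply (is_lim_seq_inv INR p_infty); [apply is_lim_seq_INR | discriminate].
Qed.

Lemma is_Clim_rgamma_seq (z : C) : is_Clim (rgamma_seq z) (Crgamma z).
Proof.
  destruct (rgamma_seq_increment z) as [K [HK H]]; split.
  - apply Lim_seq_correct'; apply ex_lim_seq_small_increments with K; intros n.
    + eapply Rle_trans; [apply fst_le_Cmod | apply H].
    + eapply Rle_trans; [| apply H]; apply (fst_le_Cmod (Cminus _ _)).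
  - apply Lim_seq_correct'; apply ex_lim_seq_small_increments with K; intros n.
    + eapply Rle_trans; [apply snd_le_Cmod | apply H].
    + eapply Rle_trans; [| apply H]; apply (snd_le_Cmod (Cminus _ _)).
Qed.

Lemma Cpoch_S (z : C) (n : nat) :
  Cpoch z (S n) = Cmult (Cpoch z n) (Cplus z (RtoC (INR (S n)))).
Proof. reflexivity. Qed.

Lemma Cpoch_shift (z : C) (n : nat) :
  Cmult z (Cpoch (Cplus z (RtoC 1)) n) = Cpoch z (S n).
Proof.
  induction n.
  - reflexivity.
  - rewrite Cpoch_S, Cmult_assoc, IHn, (Cpoch_S z (S n)), (S_INR (S n)), RtoC_plus; ring.
Qed.

(** The [n]-th terms of the two sides differ by the factor [(z+n+1)/n = 1 + (z+1)/n], which tends to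
    1. *)
Lemma Crgamma_shift (z : C) : Crgamma z = Cmult z (Crgamma (Cplus z (RtoC 1))).
Proof.
  assert (L : is_Clim (fun n => Cplus (RtoC 1) (Cmult (Cplus z (RtoC 1)) (RtoC (/ INR n)))) (RtoC 1)).
  { assert (I : is_lim_seq (fun n => / INR n) 0).
    { apply (is_lim_seq_inv INR p_infty); [apply is_lim_seq_INR | discriminate]. }
    split; simpl.
    - apply is_lim_seq_ext with (fun n => 1 + (fst z + 1) * / INR n); [intros; ring |].
      replace (Finite 1) with (Finite (1 + (fst z + 1) * 0)) by (f_equal; ring).
      apply is_lim_seq_plus'; [apply is_lim_seq_const |].
      apply (is_lim_seq_scal_l _ (fst z + 1) (Finite 0)); auto.
    - apply is_lim_seq_ext with (fun n => snd z * / INR n); [intros; ring |].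
      replace (Finite 0) with (Finite (snd z * 0)) by (f_equal; ring).
      apply (is_lim_seq_scal_l _ (snd z) (Finite 0)); auto. }
  generalize (is_Clim_mult _ _ _ _ (is_Clim_rgamma_seq z) L); rewrite Cmult_1_r; intros A.
  generalize (is_Clim_mult _ _ _ _ (is_Clim_const z) (is_Clim_rgamma_seq (Cplus z (RtoC 1)))); intros B.
  apply is_Clim_unique with (1 := A); apply is_Clim_ext_loc with (2 := B).
  exists 1%nat; intros n Hn.
  assert (Hp : 0 < INR n) by (apply lt_0_INR; lia).
  unfold rgamma_seq; rewrite Cpow_pos_plus, Cpow_pos_one by auto.
  assert (N1 : RtoC (INR (fact n)) <> RtoC 0) by (apply RtoC_neq0; generalize (INR_fact_pos n); lra).
  assert (N2 : RtoC (INR n) <> RtoC 0) by (apply RtoC_neq0; lra).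
  assert (N3 := Cpow_pos_neq0 (INR n) z).
  transitivity (Cdiv (Cmult z (Cpoch (Cplus z (RtoC 1)) n))
    (Cmult (RtoC (INR (fact n))) (Cmult (Cpow_pos (INR n) z) (RtoC (INR n))))).
  { field; auto. }
  rewrite Cpoch_shift, Cpoch_S, S_INR, RtoC_plus, RtoC_inv by lra.
  field; auto.
Qed.

Lemma Cpoch_RtoC (x : R) (n : nat) : snd (Cpoch (RtoC x) n) = 0.
Proof. induction n; simpl; auto; rewrite IHn; ring. Qed.

Lemma rgamma_seq_RtoC (x : R) (n : nat) :
  rgamma_seq (RtoC x) n = RtoC (fst (Cpoch (RtoC x) n) / (INR (fact n) * Rpower (INR n) x)).
Proof.
  unfold rgamma_seq; rewrite Cpow_pos_RtoC, <- RtoC_mult.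
  rewrite (RtoC_fst_snd (Cpoch _ _)) at 1 by apply Cpoch_RtoC.
  rewrite <- RtoC_div; auto.
  apply Rmult_integral_contrapositive_currified.
  - generalize (INR_fact_pos n); lra.
  - apply Rgt_not_eq, exp_pos.
Qed.

Lemma Crgamma_RtoC (x : R) : Crgamma (RtoC x) = RtoC (Rrgamma x).
Proof.
  apply RtoC_fst_snd.
  assert (H := proj2 (is_Clim_rgamma_seq (RtoC x))).
  apply is_lim_seq_unique in H.
  rewrite (Lim_seq_ext _ (fun _ => 0)), Lim_seq_const in H.
  - injection H; auto.
  - intros n; rewrite rgamma_seq_RtoC; auto.
Qed.

Lemma Rrgamma_shift (x : R) : Rrgamma x = x * Rrgamma (x + 1).
Proof.
  assert (H := Crgamma_shift (RtoC x)).
  rewrite <- RtoC_plus, !Crgamma_RtoC, <- RtoC_mult in H; injection H; auto.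
Qed.

(** * Nonvanishing of the reciprocal Gamma function on the positive reals *)

Lemma Rpower_bernoulli (a s : R) : 0 < a <= 1 -> 0 <= s -> Rpower (1 + s) a <= 1 + a * s.
Proof.
  intros Ha Hs.
  (* The function [(1 + a y) (1 + y)^(-a)] equals 1 at [y = 0] and has a nonnegative derivative
     because [a <= 1]. *)
  assert (H : 1 <= (1 + a * s) * Rpower (1 + s) (- a)).
  { destruct (MVT_gen (fun y => (1 + a * y) * exp (- a * ln (1 + y))) 0 s
      (fun y => a * (1 - a) * y * / (1 + y) * exp (- a * ln (1 + y)))) as [c [Hc E]].
    - intros x Hx; rewrite Rmin_left, Rmax_right in Hx by lra.
      auto_derive; [lra |]; field; lra.
    - intros x Hx; rewrite Rmin_left, Rmax_right in Hx by lra.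
      apply continuity_pt_filterlim.
      apply (ex_derive_continuous (K := R_AbsRing) (V := R_NormedModule)
               (fun y => (1 + a * y) * exp (- a * ln (1 + y)))).
      auto_derive; lra.
    - rewrite Rmin_left, Rmax_right in Hc by lra.
      rewrite Rplus_0_r, ln_1, !Rmult_0_r, exp_0 in E.
      unfold Rpower.
      assert (0 <= a * (1 - a) * c * / (1 + c) * exp (- a * ln (1 + c)) * (s - 0)).
      { repeat apply Rmult_le_pos; try lra.
        - apply Rlt_le, Rinv_0_lt_compat; lra.
        - apply Rlt_le, exp_pos. }
      lra. }
  assert (P : 0 < Rpower (1 + s) a) by apply exp_pos.
  apply (Rmult_le_compat_r _ _ _ (Rlt_le _ _ P)) in H.
  rewrite Rmult_assoc, <- Rpower_plus in H.
  replace (- a + a) with 0 in H by ring.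
  rewrite Rpower_O in H by lra; lra.
Qed.

(** Bernoulli's inequality gives [x (x+1) ... (x+n) >= x n! (n+1)^x] by induction, so the limit is
    at least [x]. The base [n+1] instead of [n] lets the induction start at [n = 0]. *)
Lemma Rrgamma_pos_unit (x : R) : 0 < x <= 1 -> 0 < Rrgamma x.
Proof.
  intros Hx.
  assert (H : forall n, x * (INR (fact n) * Rpower (INR (S n)) x) <= fst (Cpoch (RtoC x) n)).
  { induction n.
    - simpl; unfold Rpower; rewrite ln_1, Rmult_0_r, exp_0; lra.
    - assert (P := INR_S_pos n).
      change (fst (Cpoch (RtoC x) (S n))) with
        (fst (Cpoch (RtoC x) n) * (x + INR (S n)) - snd (Cpoch (RtoC x) n) * (0 + 0)).
      rewrite Cpoch_RtoC, Rmult_0_l, Rminus_0_r.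
      eapply Rle_trans; [| apply Rmult_le_compat_r; [lra | exact IHn]].
      change (fact (S n)) with (S n * fact n)%nat; rewrite mult_INR.
      replace (INR (S (S n))) with (INR (S n) * (1 + / INR (S n)))
        by (rewrite (S_INR (S n)); field; lra).
      assert (I : 0 < / INR (S n)) by (apply Rinv_0_lt_compat; auto).
      rewrite <- Rpower_mult_distr by lra.
      generalize (Rpower_bernoulli x (/ INR (S n)) Hx ltac:(lra)); intros Bn.
      set (q := x * (INR (fact n) * Rpower (INR (S n)) x)).
      replace (x * (INR (S n) * INR (fact n) * (Rpower (INR (S n)) x * Rpower (1 + / INR (S n)) x)))
        with ((q * INR (S n)) * Rpower (1 + / INR (S n)) x) by (unfold q; ring).
      replace (q * (x + INR (S n))) with ((q * INR (S n)) * (1 + x * / INR (S n)))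
        by (field; lra).
      apply Rmult_le_compat_l; auto.
      unfold q; repeat apply Rmult_le_pos; try lra.
      + apply Rlt_le, INR_fact_pos.
      + apply Rlt_le, exp_pos. }
  assert (L := proj1 (is_Clim_rgamma_seq (RtoC x))).
  apply Rlt_le_trans with x; [lra |].
  apply (is_lim_seq_le_loc (fun _ => x) (fun n => fst (rgamma_seq (RtoC x) n)) x (Rrgamma x)).
  - exists 1%nat; intros n Hn.
    rewrite rgamma_seq_RtoC; simpl.
    assert (Q : 0 < INR (fact n) * Rpower (INR n) x).
    { apply Rmult_lt_0_compat; [apply INR_fact_pos | apply exp_pos]. }
    apply Rle_div_r; auto.
    eapply Rle_trans; [| apply H]; apply Rmult_le_compat_l; [lra |].
    apply Rmult_le_compat_l; [apply Rlt_le, INR_fact_pos |].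
    apply Rle_Rpower_l; [lra |]; split; [apply lt_0_INR; lia | apply le_INR; lia].
  - apply is_lim_seq_const.
  - exact L.
Qed.

Lemma Rrgamma_neq0 (x : R) : 0 < x -> Rrgamma x <> 0.
Proof.
  intros Hx.
  assert (H : forall n, forall x, 0 < x <= INR n + 1 -> Rrgamma x <> 0).
  { induction n; intros y Hy.
    - apply Rgt_not_eq, Rrgamma_pos_unit; simpl in Hy; lra.
    - rewrite S_INR in Hy; destruct (Rle_dec y 1).
      + apply Rgt_not_eq, Rrgamma_pos_unit; lra.
      + intros E; apply (IHn (y - 1)); [lra |].
        rewrite Rrgamma_shift; replace (y - 1 + 1) with y by ring; rewrite E; ring. }
  destruct (nfloor_ex x) as [n Hn]; [lra |]; apply (H n); lra.
Qed.

(** * Entire power series *)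

Definition entire (a : nat -> R) : Prop := CV_radius a = p_infty.

Lemma entire_ex_pseries (a : nat -> R) : entire a -> forall z, ex_pseries a z.
Proof. intros H z; apply CV_radius_inside; rewrite H; exact I. Qed.

Lemma ex_pseries_entire (a : nat -> R) : (forall z, ex_pseries a z) -> entire a.
Proof.
  intros H; unfold entire.
  destruct (CV_radius a) as [r | |] eqn:E; auto.
  - exfalso; apply (CV_disk_outside a (Rabs r + 1)).
    + rewrite E; simpl; rewrite (Rabs_pos_eq (Rabs r + 1)).
      * generalize (Rle_abs r); lra.
      * generalize (Rabs_pos r); lra.
    + apply ex_series_lim_0; apply (ex_pseries_R a), H.
  - exfalso; generalize (CV_radius_ge_0 a); rewrite E; simpl; auto.
Qed.

Lemma entire_ext (a b : nat -> R) : (forall n, a n = b n) -> entire a -> entire b.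
Proof. intros H E; unfold entire; rewrite <- (CV_radius_ext a b H); exact E. Qed.

Lemma entire_lin (c d : R) (a b : nat -> R) :
  entire a -> entire b -> entire (fun n => c * a n + d * b n).
Proof.
  intros A B; apply ex_pseries_entire; intros z; apply ex_pseries_R.
  apply ex_series_ext with (fun n => plus (scal c (a n * z ^ n)) (scal d (b n * z ^ n))).
  { intros n; unfold plus, scal; simpl; unfold mult; simpl; ring. }
  apply (ex_series_plus (V := R_NormedModule)).
  - apply (ex_series_scal (V := R_NormedModule) c (fun n => a n * z ^ n)).
    apply ex_pseries_R, entire_ex_pseries; auto.
  - apply (ex_series_scal (V := R_NormedModule) d (fun n => b n * z ^ n)).
    apply ex_pseries_R, entire_ex_pseries; auto.
Qed.

Lemma PSeries_lin (c d : R) (a b : nat -> R) (z : R) : entire a -> entire b ->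
  PSeries (fun n => c * a n + d * b n) z = c * PSeries a z + d * PSeries b z.
Proof.
  intros A B; rewrite <- !PSeries_scal, <- PSeries_plus.
  - reflexivity.
  - apply ex_pseries_scal; [apply Rmult_comm | apply entire_ex_pseries; auto].
  - apply ex_pseries_scal; [apply Rmult_comm | apply entire_ex_pseries; auto].
Qed.

Lemma entire_derive (a : nat -> R) : entire a -> entire (PS_derive a).
Proof. intros H; unfold entire; rewrite CV_radius_derive; auto. Qed.

Lemma is_derive_entire (a : nat -> R) (z : R) : entire a ->
  is_derive (PSeries a) z (PSeries (PS_derive a) z).
Proof. intros H; apply is_derive_PSeries; rewrite H; exact I. Qed.

Definition Rshift (a : nat -> R) (n : nat) : R := match n with O => 0 | S m => a m end.

Lemma entire_shift (a : nat -> R) : entire a -> entire (Rshift a).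
Proof. intros H; unfold entire; rewrite <- H; apply (CV_radius_incr_1 a). Qed.

Lemma PSeries_shift (a : nat -> R) (z : R) : PSeries (Rshift a) z = z * PSeries a z.
Proof. apply (PSeries_incr_1 a). Qed.

(** The factor [c - n/2] is the action of [c - (z/2) d/dz] on coefficients, the operator by which
    the contiguity relation for [K] raises the order. *)
Lemma entire_euler (a : nat -> R) (c : R) : entire a ->
  entire (fun n => (c - INR n / 2) * a n).
Proof.
  intros H; apply entire_ext with (fun n => c * a n + (- / 2) * Rshift (PS_derive a) n).
  - intros [| n]; unfold Rshift, PS_derive; [simpl; field | field].
  - apply entire_lin; auto; apply entire_shift, entire_derive; auto.
Qed.

Lemma PSeries_euler (a : nat -> R) (c z : R) : entire a ->
  PSeries (fun n => (c - INR n / 2) * a n) z =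
  c * PSeries a z - z / 2 * PSeries (PS_derive a) z.
Proof.
  intros H; rewrite (PSeries_ext _ (fun n => c * a n + (- / 2) * Rshift (PS_derive a) n)).
  - rewrite PSeries_lin, PSeries_shift; auto; [field | apply entire_shift, entire_derive; auto].
  - intros [| n]; unfold Rshift, PS_derive; [simpl; field | field].
Qed.

Lemma entire_exp : entire (fun n => / INR (fact n)).
Proof. apply ex_pseries_entire; intros z; eexists; apply is_exp_Reals. Qed.

Lemma entire_le (a : nat -> R) (B : R) :
  (forall n, Rabs (a n) <= B * / INR (fact n)) -> entire a.
Proof.
  intros H; apply ex_pseries_entire; intros z; apply ex_pseries_R.
  apply (ex_series_le (K := R_AbsRing) (V := R_CompleteNormedModule)) with
    (fun n => scal B (/ INR (fact n) * Rabs z ^ n)).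
  - intros n; unfold norm, scal; simpl; unfold abs, mult; simpl.
    rewrite Rabs_mult, RPow_abs, <- Rmult_assoc.
    apply Rmult_le_compat_r; [apply Rabs_pos | apply H].
  - apply (ex_series_scal (V := R_NormedModule) B (fun n => / INR (fact n) * Rabs z ^ n)).
    apply (ex_pseries_R (fun n => / INR (fact n))).
    apply entire_ex_pseries, entire_exp.
Qed.

(** With [r = 2 |z| + 1 >= 1] the terms [a n * r^n] are bounded, and
    [r^(s k) >= r^(2k) >= (4 z^2)^k]; this leaves a geometric series of ratio 1/4. The index map [s]
    covers the even and the odd part at once. *)
Lemma ex_pseries_even_odd (a : nat -> R) (z : R) (s : nat -> nat) : entire a ->
  (forall k, (2 * k <= s k)%nat) -> ex_pseries (fun k => a (s k)) (z ^ 2).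
Proof.
  intros E Hs; set (r := 2 * Rabs z + 1).
  assert (Hr : 1 <= r) by (unfold r; generalize (Rabs_pos z); lra).
  destruct (filterlim_bounded (K := R_AbsRing) (V := R_NormedModule) (fun n => a n * r ^ n)) as [M HM].
  { exists 0; apply ex_series_lim_0, ex_pseries_R, entire_ex_pseries; auto. }
  apply ex_pseries_R.
  apply (ex_series_le (K := R_AbsRing) (V := R_CompleteNormedModule)) with
    (fun n => scal M ((/ 4) ^ n)).
  - intros k; unfold norm, scal; simpl; unfold abs, mult; simpl.
    specialize (HM (s k)); unfold norm in HM; simpl in HM; unfold abs in HM; simpl in HM.
    rewrite Rabs_mult, (Rabs_pos_eq (r ^ _)) in HM by (apply pow_le; lra).
    rewrite Rabs_mult.
    assert (H4 : 0 < 4 ^ k) by (apply pow_lt; lra).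
    rewrite pow_inv; apply (Rle_div_r _ M (4 ^ k)); [auto |].
    eapply Rle_trans; [| exact HM]; rewrite Rmult_assoc; apply Rmult_le_compat_l; [apply Rabs_pos |].
    eapply Rle_trans; [| apply Rle_pow with (2 := Hs k); auto].
    rewrite pow_mult, <- RPow_abs, <- Rpow_mult_distr; apply pow_incr.
    replace (z * (z * 1)) with (z * z) by ring; rewrite Rabs_mult; unfold r.
    generalize (Rabs_pos z); simpl; intros; split; nra.
  - apply (ex_series_scal (V := R_NormedModule) M (fun n => (/ 4) ^ n)).
    apply ex_series_geom; rewrite Rabs_pos_eq; lra.
Qed.

Lemma PSeries_even (a : nat -> R) (z : R) : entire a ->
  (forall k, a (2 * k + 1)%nat = 0) ->
  PSeries a z = PSeries (fun k => a (2 * k)%nat) (z ^ 2).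
Proof.
  intros H H0.
  rewrite PSeries_odd_even by (apply ex_pseries_even_odd; try (intros; lia); auto).
  rewrite (PSeries_ext (fun n => a (2 * n + 1)%nat) (fun n => 0)) by auto.
  rewrite PSeries_const_0; ring.
Qed.

(** * Finite sums *)

Fixpoint Csum (f : nat -> C) (n : nat) : C :=
  match n with O => RtoC 0 | S m => Cplus (Csum f m) (f m) end.

Lemma Csum_ext (f g : nat -> C) (n : nat) :
  (forall k, (k < n)%nat -> f k = g k) -> Csum f n = Csum g n.
Proof.
  intros H; induction n; simpl; auto.
  rewrite IHn, H by (auto; intros; apply H; lia); reflexivity.
Qed.

Lemma Csum_zero (f : nat -> C) (n : nat) :
  (forall k, (k < n)%nat -> f k = RtoC 0) -> Csum f n = RtoC 0.
Proof.
  intros H; induction n; simpl; auto.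
  rewrite IHn, H by (auto; intros; apply H; lia); ring.
Qed.

Lemma Csum_plus (f g : nat -> C) (n : nat) :
  Csum (fun k => Cplus (f k) (g k)) n = Cplus (Csum f n) (Csum g n).
Proof. induction n; simpl; [| rewrite IHn]; ring. Qed.

Lemma Csum_scal (c : C) (f : nat -> C) (n : nat) :
  Csum (fun k => Cmult c (f k)) n = Cmult c (Csum f n).
Proof. induction n; simpl; [| rewrite IHn]; ring. Qed.

Lemma Csum_S_left (f : nat -> C) (n : nat) :
  Csum f (S n) = Cplus (f O) (Csum (fun k => f (S k)) n).
Proof.
  induction n; [simpl; ring |].
  change (Csum f (S (S n))) with (Cplus (Csum f (S n)) (f (S n))); rewrite IHn; simpl; ring.
Qed.

Lemma Csum_tail (f : nat -> C) (n m : nat) : (n <= m)%nat ->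
  (forall k, (n <= k < m)%nat -> f k = RtoC 0) -> Csum f m = Csum f n.
Proof.
  intros Hn; induction Hn; intros H; auto.
  simpl; rewrite IHHn, H by (intros; try apply H; lia); ring.
Qed.

Lemma Csum_swap (f : nat -> nat -> C) (n m : nat) :
  Csum (fun i => Csum (fun j => f i j) m) n = Csum (fun j => Csum (fun i => f i j) n) m.
Proof.
  induction n; simpl.
  - symmetry; apply Csum_zero; auto.
  - rewrite IHn, <- Csum_plus; reflexivity.
Qed.

Lemma PSeries_finite (a : nat -> R) (D : nat) (z : R) : entire a ->
  (forall n, (D <= n)%nat -> a n = 0) ->
  RtoC (PSeries a z) = Csum (fun n => RtoC (a n * z ^ n)) D.
Proof.
  revert a; induction D; intros a E H.
  - simpl; f_equal; rewrite (PSeries_ext a (fun _ => 0)), PSeries_const_0; auto.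
    intros; apply H; lia.
  - rewrite Csum_S_left, PSeries_decr_1 by (apply entire_ex_pseries; auto).
    rewrite RtoC_plus, RtoC_mult, (IHD (PS_decr_1 a)).
    + rewrite <- Csum_scal; f_equal; [f_equal; simpl; ring |].
      apply Csum_ext; intros k _; rewrite <- RtoC_mult; f_equal; unfold PS_decr_1; simpl; ring.
    + unfold entire; rewrite CV_radius_decr_1; auto.
    + intros n Hn; apply H; lia.
Qed.

(** * The Macdonald function of half-integer order *)

(* Taylor coefficients of [(z/2)^(2l+1) Ktilde (l+1/2) z], up to a constant factor;
   the recursion in [l] is the contiguity relation [f_(l+1) = (l+1/2) f_l - (z/2) f_l']. *)
Fixpoint kcoef (l n : nat) : R :=
  match l with
  | O => (-1) ^ n / INR (fact n)
  | S l' => (INR l' + / 2 - INR n / 2) * kcoef l' n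
  end.

(* The same contiguity relation after factoring out [exp (-z)]. *)
Fixpoint pcoef (l n : nat) : R :=
  match l with
  | O => match n with O => 1 | S _ => 0 end
  | S l' => (INR l' + / 2 - INR n / 2) * pcoef l' n + / 2 * Rshift (pcoef l') n
  end.

Lemma entire_kcoef (l : nat) : entire (kcoef l).
Proof.
  induction l; simpl.
  - apply entire_le with 1; intros n.
    unfold Rdiv; rewrite Rabs_mult, pow_1_abs, Rmult_1_l, Rmult_1_l.
    rewrite Rabs_pos_eq; [apply Rle_refl |].
    apply Rlt_le, Rinv_0_lt_compat, INR_fact_pos.
  - apply entire_euler; auto.
Qed.

Lemma pcoef_above (l n : nat) : (l < n)%nat -> pcoef l n = 0.
Proof.
  revert n; induction l; intros [| n] H; simpl; try lia; auto.
  rewrite !IHl by lia; ring.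
Qed.

Lemma pcoef_top (l : nat) : pcoef l l = / 2 ^ l.
Proof.
  induction l; simpl.
  - field.
  - rewrite IHl, pcoef_above by lia; field; apply pow_nonzero; lra.
Qed.

(** Kummer's equation: the polynomial is a multiple of [1F1(-l; -2l; 2v)]. The factor [n - 2l] stays
    on the left because it vanishes at [n = 2l]. *)
Lemma pcoef_rec (l n : nat) :
  INR (S n) * (INR n - 2 * INR l) * pcoef l (S n) = 2 * (INR n - INR l) * pcoef l n.
Proof.
  revert n; induction l; intros n.
  - simpl pcoef; destruct n; simpl; ring.
  - assert (H := IHl n); simpl pcoef; unfold Rshift.
    destruct n as [| n].
    + rewrite !S_INR in *; simpl INR in *.
      generalize (Rmult_eq_compat_l (INR l + 1) _ _ H); lra.
    + assert (H' := IHl n); rewrite !S_INR in *.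
      set (p2 := pcoef l (S (S n))) in *; set (p1 := pcoef l (S n)) in *.
      set (p0 := pcoef l n) in *; set (m := INR n) in *; set (L := INR l) in *.
      (* The multiplier is [INR (S n) - 2 * INR (S l)], the factor in the goal; afterwards the goal
         is linear in the monomials of the two hypotheses. *)
      generalize (Rmult_eq_compat_l (m - 1 - 2 * L) _ _ H); lra.
Qed.

Lemma entire_pcoef (l : nat) : entire (pcoef l).
Proof.
  induction l; simpl.
  - apply entire_le with 1; intros [| n].
    + simpl; rewrite Rabs_R1; lra.
    + rewrite Rabs_R0, Rmult_1_l; apply Rlt_le, Rinv_0_lt_compat, INR_fact_pos.
  - apply entire_ext with (fun n => 1 * ((INR l + / 2 - INR n / 2) * pcoef l n) + / 2 * Rshift (pcoef l) n).
    { intros; ring. }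
    apply entire_lin; [apply entire_euler | apply entire_shift]; auto.
Qed.

Lemma PSeries_kcoef (l : nat) (z : R) :
  PSeries (kcoef l) z = exp (- z) * PSeries (pcoef l) z.
Proof.
  revert z; induction l; intros z.
  - assert (E : RtoC (PSeries (pcoef 0) z) = RtoC 1).
    { rewrite (PSeries_finite _ 1) by (first [apply entire_pcoef | intros; apply pcoef_above; lia]).
      simpl; rewrite <- RtoC_plus; f_equal; ring. }
    apply RtoC_inj in E.
    rewrite E, Rmult_1_r; apply is_pseries_unique.
    apply is_pseries_R.
    apply is_series_ext with (2 := proj1 (is_pseries_R _ _ _) (is_exp_Reals (- z))); intros n.
    replace (- z) with ((-1) * z) by ring; rewrite Rpow_mult_distr; simpl; unfold Rdiv; ring.
  - change (kcoef (S l)) with (fun n => (INR l + / 2 - INR n / 2) * kcoef l n).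
    rewrite PSeries_euler by apply entire_kcoef.
    rewrite (PSeries_ext (pcoef (S l))
      (fun n => 1 * ((INR l + / 2 - INR n / 2) * pcoef l n) + / 2 * Rshift (pcoef l) n))
      by (intros; simpl; ring).
    rewrite PSeries_lin, PSeries_euler, PSeries_shift;
      [| apply entire_pcoef | apply entire_euler, entire_pcoef | apply entire_shift, entire_pcoef].
    (* Differentiating [exp (-z)] contributes the extra term [- exp (-z) p], which accounts for the
       summand [Rshift] in [pcoef]. *)
    assert (D : PSeries (PS_derive (kcoef l)) z =
      exp (- z) * PSeries (PS_derive (pcoef l)) z - exp (- z) * PSeries (pcoef l) z).
    { rewrite <- (is_derive_unique _ _ _ (is_derive_entire (kcoef l) z (entire_kcoef l))).
      rewrite (Derive_ext _ (fun z => exp (- z) * PSeries (pcoef l) z)) by auto.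
      apply is_derive_unique.
      assert (H := is_derive_entire (pcoef l) z (entire_pcoef l)).
      auto_derive; [exists (PSeries (PS_derive (pcoef l)) z); auto |].
      replace (Derive (fun x => PSeries (pcoef l) x) z) with (PSeries (PS_derive (pcoef l)) z)
        by (symmetry; apply is_derive_unique; exact H).
      ring. }
    rewrite D, IHl; field.
Qed.

(** * Bessel series of half-integer order as even and odd parts of one series *)

Lemma Rrgamma_half (k : nat) :
  Rrgamma (INR k + / 2) / (INR (fact k) * 4 ^ k) = Rrgamma (/ 2) / INR (fact (2 * k)).
Proof.
  induction k.
  - simpl; rewrite Rplus_0_l; field.
  - assert (P := pos_INR k).
    replace (2 * S k)%nat with (S (S (2 * k))) by lia.
    rewrite !fact_simpl, !mult_INR, !S_INR, mult_INR; simpl (INR 2); simpl (4 ^ _).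
    rewrite (Rrgamma_shift (INR k + / 2)) in IHk.
    replace (INR k + / 2 + 1) with (INR k + 1 + / 2) in IHk by ring.
    assert (F := INR_fact_pos k); assert (F2 := INR_fact_pos (2 * k)).
    assert (Q : 0 < 4 ^ k) by (apply pow_lt; lra).
    apply (Rmult_eq_reg_l ((INR k + / 2) * (INR k + 1) * 4)); [| apply Rgt_not_eq; nra].
    transitivity ((INR k + / 2) * Rrgamma (INR k + 1 + / 2) / (INR (fact k) * 4 ^ k)).
    + field; repeat split; lra.
    + rewrite IHk; field; repeat split; lra.
Qed.

(** The left side is a coefficient of [I_(-(l+1/2))]. Raising [l] by one brings the factor
    [k - l - 1/2] from the functional equation, the negative of the factor in [kcoef]; hence the
    sign [(-1)^l], which the sine in [BesselK] cancels later. *)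
Lemma kcoef_even (l k : nat) :
  Rrgamma (INR k + / 2 - INR l) / (INR (fact k) * 4 ^ k) =
  (-1) ^ l * Rrgamma (/ 2) * kcoef l (2 * k).
Proof.
  assert (F := INR_fact_pos k); assert (Q : 0 < 4 ^ k) by (apply pow_lt; lra).
  induction l.
  - simpl (INR 0); rewrite Rminus_0_r, Rrgamma_half; simpl kcoef.
    change (k + (k + 0))%nat with (2 * k)%nat; rewrite pow_1_even; simpl pow.
    field; apply Rgt_not_eq, INR_fact_pos.
  - rewrite Rrgamma_shift, S_INR.
    replace (INR k + / 2 - (INR l + 1) + 1) with (INR k + / 2 - INR l) by ring.
    unfold Rdiv in *; rewrite Rmult_assoc, IHl.
    change (kcoef (S l) (2 * k)) with ((INR l + / 2 - INR (2 * k) / 2) * kcoef l (2 * k)).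
    rewrite mult_INR; simpl (INR 2); simpl pow; field.
Qed.

(** The left side is a coefficient of [I_(l+1/2)]. The induction passes from [(l, k+1)] to
    [(l+1, k)], which keeps both the Gamma argument and the index of [kcoef] fixed. *)
Lemma kcoef_odd (l k : nat) :
  Rrgamma (INR k + INR l + 3 / 2) / (INR (fact k) * 2 ^ (2 * k + 2 * l + 1)) =
  - ((-1) ^ l * Rrgamma (/ 2) * kcoef l (2 * (l + k) + 1)).
Proof.
  revert k; induction l; intros k.
  - replace (2 * k + 2 * 0 + 1)%nat with (S (2 * k)) by lia.
    replace (2 * (0 + k) + 1)%nat with (S (2 * k)) by lia.
    change (kcoef 0 (S (2 * k))) with ((-1) ^ S (2 * k) / INR (fact (S (2 * k)))).
    rewrite pow_1_odd, fact_simpl, mult_INR, S_INR, mult_INR.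
    replace (2 ^ S (2 * k)) with (2 * 4 ^ k)
      by (rewrite <- tech_pow_Rmult, pow_mult; do 2 f_equal; ring).
    assert (H := Rrgamma_half k); rewrite Rrgamma_shift in H.
    replace (INR k + / 2 + 1) with (INR k + 3 / 2) in H by field.
    simpl (INR 0); simpl (INR 2); simpl pow; rewrite Rplus_0_r.
    assert (F := INR_fact_pos k); assert (F2 := INR_fact_pos (2 * k)).
    assert (Q : 0 < 4 ^ k) by (apply pow_lt; lra); assert (P := pos_INR k).
    apply (Rmult_eq_reg_l (2 * INR k + 1)); [| lra].
    transitivity ((INR k + / 2) * Rrgamma (INR k + 3 / 2) / (INR (fact k) * 4 ^ k)).
    + field; repeat split; lra.
    + rewrite H; field; repeat split; lra.
  - assert (H := IHl (S k)).
    replace (2 * (S l + k) + 1)%nat with (2 * (l + S k) + 1)%nat by lia.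
    replace (2 * k + 2 * S l + 1)%nat with (2 * S k + 2 * l + 1)%nat by lia.
    change (kcoef (S l) (2 * (l + S k) + 1)) with
      ((INR l + / 2 - INR (2 * (l + S k) + 1) / 2) * kcoef l (2 * (l + S k) + 1)).
    rewrite plus_INR, mult_INR, plus_INR; simpl (INR 2); simpl (INR 1).
    rewrite fact_simpl, mult_INR in H.
    replace (INR k + INR (S l) + 3 / 2) with (INR (S k) + INR l + 3 / 2) by (rewrite !S_INR; ring).
    assert (F := INR_fact_pos k); assert (P := INR_S_pos k).
    assert (Q : 0 < 2 ^ (2 * S k + 2 * l + 1)) by (apply pow_lt; lra).
    transitivity (INR (S k) * (Rrgamma (INR (S k) + INR l + 3 / 2) /
       (INR (S k) * INR (fact k) * 2 ^ (2 * S k + 2 * l + 1)))).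
    + field; repeat split; lra.
    + rewrite H; simpl pow; field.
Qed.

(** The factor [l' + 1/2 - (2i+1)/2] is zero at [l' = i]. This gap in the odd part reflects that
    [(z/2)^nu I_nu(z)] starts at the power [2 nu = 2l+1]. *)
Lemma kcoef_odd_small (l i : nat) : (i < l)%nat -> kcoef l (2 * i + 1) = 0.
Proof.
  induction l; intros H; [lia |].
  change (kcoef (S l) (2 * i + 1)) with
    ((INR l + / 2 - INR (2 * i + 1) / 2) * kcoef l (2 * i + 1)).
  destruct (Nat.eq_dec i l) as [-> | N].
  - rewrite plus_INR, mult_INR; simpl (INR 2); simpl (INR 1); field.
  - rewrite IHl by lia; ring.
Qed.

Lemma sin_half_odd (l : nat) : sin ((INR l + / 2) * PI) = (-1) ^ l.
Proof.
  induction l.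
  - simpl; replace ((0 + / 2) * PI) with (PI / 2) by field; apply sin_PI2.
  - rewrite S_INR; replace ((INR l + 1 + / 2) * PI) with ((INR l + / 2) * PI + PI) by ring.
    rewrite neg_sin, IHl; simpl; ring.
Qed.

Lemma Rpower_shift_nat (y a : R) (n : nat) : 0 < y ->
  Rpower y a * Rpower y (INR n - a) = y ^ n.
Proof.
  intros H; rewrite <- Rpower_plus, <- Rpower_pow by auto; f_equal; ring.
Qed.

Lemma BesselI_neg_half (l : nat) (z : R) : 0 < z ->
  Rpower (z / 2) (INR l + / 2) * BesselI (- (INR l + / 2)) z =
  (-1) ^ l * Rrgamma (/ 2) * PSeries (fun k => kcoef l (2 * k)) (z ^ 2).
Proof.
  intros Hz; unfold BesselI, PSeries; rewrite <- !Series_scal_l; apply Series_ext; intros k.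
  transitivity (Rrgamma (INR k + / 2 - INR l) / (INR (fact k) * 4 ^ k) * (z ^ 2) ^ k);
    [| rewrite kcoef_even; ring].
  replace (2 * INR k + - (INR l + / 2)) with (INR (2 * k) - (INR l + / 2))
    by (rewrite mult_INR; simpl (INR 2); ring).
  unfold Rdiv at 2; rewrite <- !Rmult_assoc, Rpower_shift_nat by lra.
  replace (INR k + - (INR l + / 2) + 1) with (INR k + / 2 - INR l) by field.
  rewrite pow_mult.
  replace ((z / 2) ^ 2) with (z ^ 2 * / 4) by field.
  rewrite Rpow_mult_distr, pow_inv.
  field; split; [apply pow_nonzero; lra | apply Rgt_not_eq, INR_fact_pos].
Qed.

Lemma BesselI_pos_half (l : nat) (z : R) : 0 < z ->
  Rpower (z / 2) (INR l + / 2) * BesselI (INR l + / 2) z =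
  - ((-1) ^ l * Rrgamma (/ 2) * (z * PSeries (fun k => kcoef l (2 * k + 1)) (z ^ 2))).
Proof.
  intros Hz; unfold BesselI, PSeries.
  rewrite (Series_incr_n_aux (fun k => kcoef l (2 * k + 1) * (z ^ 2) ^ k) l)
    by (intros; rewrite kcoef_odd_small by auto; ring).
  rewrite <- Rmult_assoc, Ropp_mult_distr_l, <- !Series_scal_l; apply Series_ext; intros k.
  transitivity (z * (Rrgamma (INR k + INR l + 3 / 2) /
    (INR (fact k) * 2 ^ (2 * k + 2 * l + 1))) * (z ^ 2) ^ (l + k));
    [| rewrite kcoef_odd; ring].
  replace (2 * INR k + (INR l + / 2)) with (INR (2 * k + 2 * l + 1) - (INR l + / 2))
    by (rewrite !plus_INR, !mult_INR; simpl (INR 2); simpl (INR 1); field).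
  unfold Rdiv at 2; rewrite <- !Rmult_assoc, Rpower_shift_nat by lra.
  replace (INR k + (INR l + / 2) + 1) with (INR k + INR l + 3 / 2) by field.
  rewrite <- pow_mult; unfold Rdiv at 1; rewrite Rpow_mult_distr, pow_inv.
  replace (2 * k + 2 * l + 1)%nat with (S (2 * (l + k)))%nat by lia.
  rewrite <- (tech_pow_Rmult z).
  field; split; [apply pow_nonzero; lra | apply Rgt_not_eq, INR_fact_pos].
Qed.

(** The two Bessel series are the even part and minus the odd part of the same series up to a common
    factor, so their difference is the whole series [kcoef l]. *)
Lemma Ktilde_half (l : nat) (z : R) : 0 < z ->
  (z / 2) ^ (2 * l + 1) * Ktilde (INR l + / 2) z =
  PI / 2 * Rrgamma (/ 2) * (exp (- z) * PSeries (pcoef l) z).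
Proof.
  intros Hz; rewrite <- PSeries_kcoef.
  assert (E := entire_ex_pseries _ (entire_kcoef l)).
  rewrite PSeries_odd_even; [| apply ex_pseries_even_odd; try (intros; lia); apply entire_kcoef ..].
  unfold Ktilde, BesselK; rewrite sin_half_odd.
  replace (- (INR l + / 2)) with (INR l + / 2 - INR (2 * l + 1)) at 1
    by (rewrite plus_INR, mult_INR; simpl (INR 2); simpl (INR 1); field).
  unfold Rminus at 1; rewrite Rpower_plus, Rpower_Ropp, Rpower_pow by lra.
  assert (N : (z / 2) ^ (2 * l + 1) <> 0) by (apply pow_nonzero; lra).
  assert (N1 : (-1) ^ l <> 0) by (apply pow_nonzero; lra).
  assert (H1 := BesselI_neg_half l z Hz); assert (H2 := BesselI_pos_half l z Hz).
  transitivity (PI / 2 * / (-1) ^ l * (Rpower (z / 2) (INR l + / 2) * BesselI (- (INR l + / 2)) z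
    - Rpower (z / 2) (INR l + / 2) * BesselI (INR l + / 2) z)).
  - field; auto.
  - rewrite H1, H2; field; auto.
Qed.

(** * Boundedness of the reciprocal Gamma function along integer shifts *)

Lemma Cmod_ge_RtoC (w : C) (k : nat) : INR k - Cmod w <= Cmod (Cplus w (RtoC (INR k))).
Proof.
  generalize (Cmod_triangle (Cplus w (RtoC (INR k))) (Copp w)).
  replace (Cplus (Cplus w (RtoC (INR k))) (Copp w)) with (RtoC (INR k)) by ring.
  rewrite Cmod_opp, Cmod_R, Rabs_pos_eq by apply pos_INR; lra.
Qed.

Lemma bounded_of_eventually_decreasing (u : nat -> R) (N : nat) :
  (forall k, (N <= k)%nat -> u (S k) <= u k) -> exists B, forall k, u k <= B.
Proof.
  intros H.
  assert (F : forall n, exists B, forall k, (k <= n)%nat -> u k <= B).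
  { induction n as [| n [B HB]].
    - exists (u O); intros k Hk; replace k with O by lia; lra.
    - exists (Rmax B (u (S n))); intros k Hk; destruct (Nat.eq_dec k (S n)) as [-> | E].
      + apply Rmax_r.
      + eapply Rle_trans; [apply HB; lia | apply Rmax_l]. }
  destruct (F N) as [B HB]; exists B; intros k.
  destruct (Nat.le_gt_cases k N) as [L | L]; auto.
  assert (G : forall d, u (N + d)%nat <= B).
  { induction d; [rewrite Nat.add_0_r; auto |].
    rewrite Nat.add_succ_r; eapply Rle_trans; [apply H; lia | exact IHd]. }
  replace k with (N + (k - N))%nat by lia; auto.
Qed.

(** By the functional equation a shift by one divides the value by [a + k], whose modulus is at
    least 1 once [k >= |a| + 1]. *)
Lemma Crgamma_bounded (a : C) : exists B, 0 <= B /\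
  forall k : nat, Cmod (Crgamma (Cplus a (RtoC (INR k)))) <= B.
Proof.
  destruct (nfloor_ex (Cmod a + 1)) as [N HN]; [generalize (Cmod_ge_0 a); lra |].
  destruct (bounded_of_eventually_decreasing
    (fun k => Cmod (Crgamma (Cplus a (RtoC (INR k))))) (S N)) as [B HB].
  - intros k Hk.
    rewrite (Crgamma_shift (Cplus a (RtoC (INR k)))), Cmod_mult.
    replace (Cplus a (RtoC (INR (S k)))) with (Cplus (Cplus a (RtoC (INR k))) (RtoC 1))
      by (rewrite S_INR, RtoC_plus; ring).
    rewrite <- (Rmult_1_l (Cmod (Crgamma _))) at 1.
    apply Rmult_le_compat_r; [apply Cmod_ge_0 |].
    generalize (Cmod_ge_RtoC a k); apply le_INR in Hk; rewrite S_INR in Hk; lra.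
  - exists B; split; auto; eapply Rle_trans; [apply Cmod_ge_0 | apply (HB O)].
Qed.

(** * Taylor coefficients of the I-Bessel factor *)

(** Coefficients in powers of [w] rather than [w^2], with zeros at odd indices: multiplication by
    [exp (-w)] mixes the parities. *)
Definition icoef (a : C) (m : nat) : C :=
  if Nat.even m then
    Cmult (RtoC (/ (4 ^ Nat.div2 m * INR (fact (Nat.div2 m)))))
          (Crgamma (Cplus a (RtoC (INR (Nat.div2 m) + 1))))
  else RtoC 0.

Lemma icoef_even (a : C) (k : nat) :
  icoef a (2 * k) = Cmult (RtoC (/ (4 ^ k * INR (fact k)))) (Crgamma (Cplus a (RtoC (INR k + 1)))).
Proof.
  unfold icoef; rewrite Nat.even_mul, Nat.div2_double; reflexivity.
Qed.

Lemma icoef_odd (a : C) (k : nat) : icoef a (2 * k + 1) = RtoC 0.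
Proof.
  unfold icoef; rewrite Nat.add_1_r, Nat.even_succ, Nat.odd_mul; reflexivity.
Qed.

(** This is Bessel's equation for [Itilde]. It holds even where [m + 2 + 2a = 0], because the
    reciprocal Gamma function then vanishes on the right side as well. *)
Lemma icoef_rec (a : C) (m : nat) :
  Cmult (Cmult (RtoC (INR (S (S m)))) (Cplus (RtoC (INR (S (S m)))) (Cmult (RtoC 2) a)))
        (icoef a (S (S m))) = icoef a m.
Proof.
  destruct (Nat.Even_or_Odd m) as [[k ->] | [k ->]].
  - replace (S (S (2 * k))) with (2 * S k)%nat by lia.
    rewrite !icoef_even, (Crgamma_shift (Cplus a (RtoC (INR k + 1)))).
    replace (Cplus a (RtoC (INR (S k) + 1))) with (Cplus (Cplus a (RtoC (INR k + 1))) (RtoC 1))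
      by (rewrite S_INR, !RtoC_plus; ring).
    assert (F := INR_fact_pos k); assert (Q : 0 < 4 ^ k) by (apply pow_lt; lra).
    assert (P := pos_INR k).
    replace (/ (4 ^ S k * INR (fact (S k)))) with (/ (4 ^ k * INR (fact k)) * / (4 * (INR k + 1)))
      by (rewrite fact_simpl, mult_INR, S_INR, <- tech_pow_Rmult; field; lra).
    rewrite mult_INR, (S_INR k), (RtoC_mult (/ _)), (RtoC_inv (4 * _)) by lra.
    simpl (INR 2); rewrite !RtoC_mult, !RtoC_plus.
    assert (RtoC (INR k) + RtoC 1 <> RtoC 0)%C by (rewrite <- RtoC_plus; apply RtoC_neq0; lra).
    field; repeat split; auto; apply RtoC_neq0; lra.
  - replace (S (S (2 * k + 1))) with (2 * S k + 1)%nat by lia.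
    rewrite !icoef_odd; ring.
Qed.

Definition Centire (a : nat -> C) : Prop :=
  entire (fun n => fst (a n)) /\ entire (fun n => snd (a n)).

Definition CPSeries (a : nat -> C) (z : R) : C :=
  (PSeries (fun n => fst (a n)) z, PSeries (fun n => snd (a n)) z).

Lemma entire_even_le (a : nat -> R) (B : R) :
  (forall k, a (2 * k + 1)%nat = 0) ->
  (forall k, Rabs (a (2 * k)%nat) <= B * / INR (fact k)) -> entire a.
Proof.
  intros H0 H; apply ex_pseries_entire; intros z.
  assert (E : ex_pseries (fun k => a (2 * k)%nat) (z ^ 2)).
  { apply entire_ex_pseries, entire_le with B; auto. }
  assert (E0 : is_pseries (fun k => a (2 * k + 1)%nat) (z ^ 2) 0).
  { assert (Z : is_pseries (fun _ : nat => 0) (z ^ 2) (PSeries (fun _ => 0) (z ^ 2)))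
      by (apply PSeries_correct, entire_ex_pseries, CV_radius_const_0).
    rewrite PSeries_const_0 in Z.
    apply is_pseries_ext with (2 := Z); intros; symmetry; apply H0. }
  destruct E as [l E]; eexists; apply is_pseries_odd_even; eauto.
Qed.

Lemma Centire_icoef (a : C) : Centire (icoef a).
Proof.
  destruct (Crgamma_bounded (Cplus a (RtoC 1))) as [B [HB H]].
  assert (Hk : forall k, Cmod (icoef a (2 * k)) <= B * / INR (fact k)).
  { intros k; rewrite icoef_even, Cmod_mult, Cmod_R.
    assert (F := INR_fact_pos k); assert (Q : 1 <= 4 ^ k) by (apply pow_R1_Rle; lra).
    rewrite Rabs_pos_eq by (apply Rlt_le, Rinv_0_lt_compat; nra).
    rewrite Rmult_comm; apply Rmult_le_compat; auto using Cmod_ge_0.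
    - apply Rlt_le, Rinv_0_lt_compat; nra.
    - replace (Cplus a (RtoC (INR k + 1))) with (Cplus (Cplus a (RtoC 1)) (RtoC (INR k)))
        by (rewrite RtoC_plus; ring); auto.
    - apply Rinv_le_contravar; nra. }
  split; apply entire_even_le with B; intros k.
  - rewrite icoef_odd; auto.
  - eapply Rle_trans; [apply fst_le_Cmod | auto].
  - rewrite icoef_odd; auto.
  - eapply Rle_trans; [apply snd_le_Cmod | auto].
Qed.

Lemma Itilde_CPSeries (a : C) (z : R) : Itilde a z = CPSeries (icoef a) z.
Proof.
  assert (S4 : forall k, (z / 2) ^ (2 * k) = (z ^ 2) ^ k * / 4 ^ k).
  { intros k; rewrite pow_mult; replace ((z / 2) ^ 2) with (z ^ 2 * / 4) by field.
    rewrite Rpow_mult_distr, pow_inv; reflexivity. }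
  assert (N : forall k, 4 ^ k <> 0 /\ INR (fact k) <> 0).
  { intros k; split; [apply pow_nonzero; lra | apply Rgt_not_eq, INR_fact_pos]. }
  destruct (Centire_icoef a) as [E1 E2].
  unfold Itilde, CPSeries; f_equal; rewrite PSeries_even;
    try (intros k; rewrite icoef_odd; reflexivity); auto; unfold PSeries; apply Series_ext;
    intros k; rewrite icoef_even, S4; simpl fst; simpl snd; destruct (N k).
  - rewrite Rmult_0_l, Rminus_0_r; field; auto.
  - rewrite Rmult_0_l, Rplus_0_r; field; auto.
Qed.

(* [d/dw (exp (-w) * a(w)) = exp (-w) * (decayD a)(w)] on Taylor coefficients. *)
Definition decayD (a : nat -> C) (n : nat) : C :=
  Cminus (Cmult (RtoC (INR (S n))) (a (S n))) (a n).

Lemma fst_decayD (a : nat -> C) (n : nat) :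
  fst (decayD a n) = 1 * PS_derive (fun n => fst (a n)) n + (-1) * fst (a n).
Proof.
  unfold decayD, PS_derive, Cminus, Cplus, Copp, Cmult, RtoC; cbn [fst snd]; ring.
Qed.

Lemma snd_decayD (a : nat -> C) (n : nat) :
  snd (decayD a n) = 1 * PS_derive (fun n => snd (a n)) n + (-1) * snd (a n).
Proof.
  unfold decayD, PS_derive, Cminus, Cplus, Copp, Cmult, RtoC; cbn [fst snd]; ring.
Qed.

Lemma Centire_decayD (a : nat -> C) : Centire a -> Centire (decayD a).
Proof.
  intros [A B]; split.
  - apply entire_ext with (fun n => 1 * PS_derive (fun n => fst (a n)) n + (-1) * fst (a n)).
    + intros n; rewrite fst_decayD; reflexivity.
    + apply entire_lin; auto; apply entire_derive; auto.
  - apply entire_ext with (fun n => 1 * PS_derive (fun n => snd (a n)) n + (-1) * snd (a n)).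
    + intros n; rewrite snd_decayD; reflexivity.
    + apply entire_lin; auto; apply entire_derive; auto.
Qed.

Definition decay (a : nat -> C) (w : R) : C := Cmult (RtoC (exp (- w))) (CPSeries a w).

Lemma is_Cder_decay (a : nat -> C) (w : R) : Centire a ->
  is_Cder (decay a) w (decay (decayD a) w).
Proof.
  intros H; assert (H' := H); destruct H as [A B].
  assert (D : is_Cder (CPSeries a) w
    (PSeries (PS_derive (fun n => fst (a n))) w, PSeries (PS_derive (fun n => snd (a n))) w)).
  { split; apply is_derive_entire; auto. }
  assert (E : is_Cder (fun y => RtoC (exp (- y))) w (RtoC (- exp (- w)))).
  { apply is_Cder_RtoC; auto_derive; auto; ring. }
  generalize (is_Cder_mult _ _ _ _ _ E D); intros G; eapply eq_rect; [exact G |].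
  unfold decay.
  replace (CPSeries (decayD a) w) with
    (Cminus (PSeries (PS_derive (fun n => fst (a n))) w, PSeries (PS_derive (fun n => snd (a n))) w)
            (CPSeries a w)).
  { rewrite RtoC_opp; ring. }
  apply C_ext; unfold CPSeries; simpl fst; simpl snd.
  - rewrite (PSeries_ext (fun n => fst (decayD a n))
      (fun n => 1 * PS_derive (fun n => fst (a n)) n + (-1) * fst (a n)))
      by (intros n; apply fst_decayD).
    rewrite PSeries_lin by (auto using entire_derive); ring.
  - rewrite (PSeries_ext (fun n => snd (decayD a n))
      (fun n => 1 * PS_derive (fun n => snd (a n)) n + (-1) * snd (a n)))
      by (intros n; apply snd_decayD).
    rewrite PSeries_lin by (auto using entire_derive); ring.
Qed.

(** By [is_Cder_decay], [decay (dcoef a k)] is the [k]-th derivative of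
    [h(w) = exp (-w) Itilde a w]. *)
Fixpoint dcoef (a : C) (k : nat) : nat -> C :=
  match k with O => icoef a | S k' => decayD (dcoef a k') end.

Lemma Centire_dcoef (a : C) (k : nat) : Centire (dcoef a k).
Proof. induction k; simpl; [apply Centire_icoef | apply Centire_decayD; auto]. Qed.

Definition Cshift (a : nat -> C) (n : nat) : C :=
  match n with O => RtoC 0 | S m => a m end.

(** The commutation rule [D w = w D + 1] for the derivative conjugated by [exp (-w)]. *)
Lemma decayD_Cshift (a : nat -> C) (n : nat) :
  decayD (Cshift a) n = Cplus (Cshift (decayD a) n) (a n).
Proof.
  destruct n; unfold decayD; cbn [Cshift]; [simpl INR; ring |].
  rewrite (S_INR (S n)), RtoC_plus; ring.
Qed.

(* Taylor-coefficient form of the [k]-th derivative of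
   [w h'' + (2a+1+2w) h' + (2a+1) h = 0], the equation solved by [h(w) = exp (-w) Itilde a w]. *)
Lemma dcoef_ode (a : C) (k n : nat) :
  Cplus (Cplus (Cshift (dcoef a (S (S k))) n)
    (Cmult (Cplus (RtoC (INR k + 1)) (Cmult (RtoC 2) a)) (dcoef a (S k) n)))
    (Cplus (Cmult (RtoC 2) (Cshift (dcoef a (S k)) n))
    (Cmult (Cplus (RtoC (2 * INR k + 1)) (Cmult (RtoC 2) a)) (dcoef a k n))) = RtoC 0.
Proof.
  revert n; induction k; intros n.
  - rewrite !RtoC_plus, !RtoC_mult; simpl (INR 0).
    destruct n as [| n]; cbn [dcoef Cshift]; unfold decayD.
    + assert (H := icoef_odd a 0); simpl (2 * 0 + 1)%nat in H; rewrite H; simpl INR; ring.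
    + assert (H := icoef_rec a n).
      rewrite (S_INR (S n)), RtoC_plus in *; rewrite (S_INR n), RtoC_plus in *.
      set (N := RtoC (INR n)) in *.
      match type of H with ?L = ?R => transitivity (Cminus L R); [ring | rewrite H; ring] end.
  (* Apply [decayD] to the identity for [k], that is, take [n+1] times its instance at [n+1] minus
     its instance at [n]; [S1] and [S2] move [decayD] past the shift, which raises the constants. *)
  - assert (H0 := IHk n); assert (H1 := IHk (S n)).
    assert (S2 : Cshift (dcoef a (S (S (S k)))) n =
      Cminus (decayD (Cshift (dcoef a (S (S k)))) n) (dcoef a (S (S k)) n))
      by (rewrite decayD_Cshift; cbn [dcoef]; ring).
    assert (S1 : Cshift (dcoef a (S (S k))) n =
      Cminus (decayD (Cshift (dcoef a (S k))) n) (dcoef a (S k) n))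
      by (rewrite decayD_Cshift; cbn [dcoef]; ring).
    assert (D2 : dcoef a (S (S k)) n =
      Cminus (Cmult (RtoC (INR (S n))) (dcoef a (S k) (S n))) (dcoef a (S k) n)) by reflexivity.
    assert (D1 : dcoef a (S k) n =
      Cminus (Cmult (RtoC (INR (S n))) (dcoef a k (S n))) (dcoef a k n)) by reflexivity.
    unfold decayD in S1, S2; rewrite (S_INR k), !RtoC_plus, !RtoC_mult in *.
    match type of H0 with ?h0 = _ => match type of H1 with ?h1 = _ =>
    match type of S1 with ?s1 = ?s1' => match type of S2 with ?s2 = ?s2' =>
    match type of D1 with ?d1 = ?d1' => match type of D2 with ?d2 = ?d2' =>
      assert (E : Cplus (Cminus (Cmult (RtoC (INR (S n))) h1) h0)
       (Cplus (Cplus (Cminus s2 s2') (Cmult (RtoC 2) (Cminus s1 s1')))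
        (Cplus (Cmult (Cplus (Cplus (RtoC (INR k)) (RtoC 1)) (Cmult (RtoC 2) a)) (Cminus d2 d2'))
          (Cmult (Cplus (Cplus (Cmult (RtoC 2) (RtoC (INR k))) (RtoC 1)) (Cmult (RtoC 2) a))
            (Cminus d1 d1')))) = RtoC 0)
    end end end end end end.
    { assert (Z : forall u v : C, u = v -> Cminus u v = RtoC 0) by (intros u v ->; ring).
      rewrite H0, H1, (Z _ _ S2), (Z _ _ S1), (Z _ _ D2), (Z _ _ D1); ring. }
    etransitivity; [| exact E]; clear; rewrite ?RtoC_plus; ring.
Qed.

(** The derivative [h^(k)(0)], by [decay_0]. *)
Definition eta (a : C) (k : nat) : C := dcoef a k O.

Lemma decay_0 (a : nat -> C) : decay a 0 = a O.
Proof.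
  unfold decay, CPSeries; rewrite !PSeries_0, Ropp_0, exp_0, Cmult_1_l.
  apply C_ext; reflexivity.
Qed.

(** The differential equation at [w = 0], where the shifted terms drop out; it is the recursion of
    [1F1(a+1/2; 2a+1; -2w)]. *)
Lemma eta_rec (a : C) (k : nat) :
  Cplus (Cmult (Cplus (RtoC (INR k + 1)) (Cmult (RtoC 2) a)) (eta a (S k)))
        (Cmult (Cplus (RtoC (2 * INR k + 1)) (Cmult (RtoC 2) a)) (eta a k)) = RtoC 0.
Proof.
  etransitivity; [| exact (dcoef_ode a k O)]; cbn [Cshift]; unfold eta; ring.
Qed.

Lemma eta_0 (a : C) : eta a O = Crgamma (Cplus a (RtoC 1)).
Proof.
  change (eta a 0) with (icoef a (2 * 0)); rewrite icoef_even.
  simpl; replace (/ (1 * 1)) with 1 by field.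
  rewrite Rplus_0_l; ring.
Qed.

(** * Derivatives of the generating function in [t] *)

(** Since [dw/dt = (x/2) (1-t)^(-2)] for [w = t x / (2(1-t))], the span of these functions is stable
    under [d/dt]. *)
Definition Phi (a : C) (x : R) (b : C) (k : nat) (t : R) : C :=
  Cmult (Cmult (Cpow_pos (1 - t) b) (RtoC ((x / 2) ^ k)))
        (decay (dcoef a k) (t * x / (2 * (1 - t)))).

Lemma is_Cder_Phi (a : C) (x : R) (b : C) (k : nat) (t : R) : t < 1 ->
  is_Cder (Phi a x b k) t
    (Cplus (Cmult (Copp b) (Phi a x (Cminus b (RtoC 1)) k t))
           (Phi a x (Cminus b (RtoC 2)) (S k) t)).
Proof.
  intros Ht.
  assert (Dw : is_derive (fun t => t * x / (2 * (1 - t))) t (x / (2 * (1 - t) ^ 2))).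
  { auto_derive; [lra |]; field; lra. }
  assert (D1 := is_Cder_comp (decay (dcoef a k)) _ t _ _ Dw
    (is_Cder_decay _ _ (Centire_dcoef a k))).
  assert (D2 := is_Cder_mult _ _ _ _ _ (is_Cder_Cpow_pos b t Ht)
    (is_Cder_const (RtoC ((x / 2) ^ k)) t)).
  generalize (is_Cder_mult _ _ _ _ _ D2 D1); intros D; eapply eq_rect; [exact D |].
  unfold Phi; cbn [dcoef].
  replace (Cpow_pos (1 - t) b) with (Cmult (RtoC ((1 - t) ^ 2)) (Cpow_pos (1 - t) (Cminus b (RtoC 2)))).
  2:{ rewrite Cpow_pos_nat_mult by lra; f_equal; simpl (INR 2); rewrite RtoC_plus; ring. }
  rewrite <- (tech_pow_Rmult (x / 2)), RtoC_mult.
  replace (RtoC (x / (2 * (1 - t) ^ 2))) with (Cmult (RtoC (x / 2)) (RtoC (/ (1 - t) ^ 2)))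
    by (rewrite <- RtoC_mult; f_equal; field; lra).
  assert (E : Cmult (RtoC (/ (1 - t) ^ 2)) (RtoC ((1 - t) ^ 2)) = RtoC 1)
    by (rewrite <- RtoC_mult; f_equal; field; lra).
  set (u := RtoC (/ (1 - t) ^ 2)) in *; set (v := RtoC ((1 - t) ^ 2)) in *.
  set (p := Cpow_pos (1 - t) (Cminus b (RtoC 2))).
  set (q := RtoC ((x / 2) ^ k)); set (d := decay (decayD _) _).
  transitivity (Cplus (Cmult (Copp b) (Cmult (Cmult (Cpow_pos (1 - t) (Cminus b (RtoC 1))) q)
      (decay (dcoef a k) (t * x / (2 * (1 - t))))))
    (Cmult (Cmult u v) (Cmult p (Cmult (Cmult q (RtoC (x / 2))) d)))); [ring |].
  rewrite E; ring.
Qed.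

(** The [j]-th derivative of [Phi]. The recursion moves the parameters [b] and [k], so that
    differentiating once more is an induction on [j] with both generalized. *)
Fixpoint Phi_n (a : C) (x : R) (j : nat) (b : C) (k : nat) (t : R) : C :=
  match j with
  | O => Phi a x b k t
  | S i => Cplus (Cmult (Copp b) (Phi_n a x i (Cminus b (RtoC 1)) k t))
                 (Phi_n a x i (Cminus b (RtoC 2)) (S k) t)
  end.

Lemma is_Cder_Phi_n (a : C) (x : R) (j : nat) (b : C) (k : nat) (t : R) : t < 1 ->
  is_Cder (Phi_n a x j b k) t (Phi_n a x (S j) b k t).
Proof.
  intros Ht; revert b k; induction j; intros b k.
  - apply is_Cder_Phi; auto.
  - cbn [Phi_n]; apply is_Cder_plus; [apply is_Cder_scal |]; apply IHj.
Qed.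

Lemma is_Cder_Csum (f : nat -> R -> C) (g : nat -> C) (n : nat) (t : R) :
  (forall i, is_Cder (f i) t (g i)) ->
  is_Cder (fun s => Csum (fun i => f i s) n) t (Csum g n).
Proof.
  intros H; induction n; simpl; [apply is_Cder_const | apply is_Cder_plus; auto].
Qed.

Lemma CDerive_n_Phi (a : C) (x : R) (f : R -> C) (c b : nat -> C) (D : nat) :
  (forall t, t < 1 -> f t = Csum (fun n => Cmult (c n) (Phi a x (b n) O t)) D) ->
  forall j t, t < 1 ->
  CDerive_n j f t = Csum (fun n => Cmult (c n) (Phi_n a x j (b n) O t)) D.
Proof.
  intros H; induction j; intros t Ht; [apply H; auto |].
  cbn [CDerive_n].
  rewrite (CDerive_ext_loc _ (fun t => Csum (fun n => Cmult (c n) (Phi_n a x j (b n) O t)) D)).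
  - apply is_Cder_CDerive, is_Cder_Csum; intros i; apply is_Cder_scal, is_Cder_Phi_n; auto.
  - apply locally_open with (D := fun s => s < 1); auto; apply open_lt.
Qed.

(* [rho b i] is the coefficient of [t^i] in [(1-t)^(-b)]. *)
Fixpoint rho (b : C) (i : nat) : C :=
  match i with
  | O => RtoC 1
  | S n => Cdiv (Cmult (rho b n) (Cplus b (RtoC (INR n)))) (RtoC (INR (S n)))
  end.

Lemma INR_S_neq0 (n : nat) : RtoC (INR (S n)) <> RtoC 0.
Proof. apply RtoC_neq0; generalize (INR_S_pos n); lra. Qed.

Lemma rho_S (b : C) (i : nat) :
  Cmult (RtoC (INR (S i))) (rho b (S i)) = Cmult (rho b i) (Cplus b (RtoC (INR i))).
Proof. cbn [rho]; field; apply INR_S_neq0. Qed.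

(** Coefficient form of [d/dt (1-t)^(-b) = b (1-t)^(-b-1)]. *)
Lemma rho_raise (b : C) (i : nat) :
  Cmult (RtoC (INR (S i))) (rho b (S i)) = Cmult b (rho (Cplus b (RtoC 1)) i).
Proof.
  induction i.
  - simpl; field; apply (INR_S_neq0 0).
  - rewrite rho_S.
    transitivity (Cdiv (Cmult (Cmult (RtoC (INR (S i))) (rho b (S i))) (Cplus b (RtoC (INR (S i)))))
                       (RtoC (INR (S i)))).
    { field; apply INR_S_neq0. }
    rewrite IHi.
    transitivity (Cdiv (Cmult b (Cmult (RtoC (INR (S i))) (rho (Cplus b (RtoC 1)) (S i))))
                       (RtoC (INR (S i)))).
    2:{ field; apply INR_S_neq0. }
    rewrite rho_S; rewrite (S_INR i) at 1; rewrite RtoC_plus; unfold Cdiv; ring.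
Qed.

Lemma rho_diff (b : C) (i : nat) :
  rho b i = Cminus (rho (Cplus b (RtoC 1)) i) (Cshift (rho (Cplus b (RtoC 1))) i).
Proof.
  destruct i; [simpl; ring |].
  assert (N := INR_S_neq0 i).
  replace (rho b (S i)) with (Cdiv (Cmult (RtoC (INR (S i))) (rho b (S i))) (RtoC (INR (S i))))
    by (field; auto).
  rewrite rho_raise; cbn [rho Cshift].
  rewrite S_INR, RtoC_plus in *; field; auto.
Qed.

(** As [w = (x/2) t/(1-t)], the term [w^m / m!] of [h] contributes [(x/2)^m t^m (1-t)^(b-m) / m!] to
    [(1-t)^b h(w)]; this is [j!] times its coefficient at [t^j], without the power of [x/2]. At
    [b = 0] these are the Lah numbers. *)
Definition lah (j m : nat) (b : C) : C :=
  if (m <=? j)%nat then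
    Cmult (RtoC (INR (fact j) / INR (fact m))) (rho (Cminus (RtoC (INR m)) b) (j - m))
  else RtoC 0.

Lemma lah_S (j m : nat) (b : C) :
  lah (S j) m b =
  Cplus (Cmult (Copp b) (lah j m (Cminus b (RtoC 1))))
        (Cshift (fun m => lah j m (Cminus b (RtoC 2))) m).
Proof.
  assert (F := INR_fact_pos j).
  destruct (Nat.le_gt_cases m j) as [L | L].
  - set (i := (j - m)%nat).
    assert (Ej : j = (i + m)%nat) by (unfold i; lia).
    set (r := rho (Cplus (Cminus (RtoC (INR m)) b) (RtoC 1)) i).
    assert (E1 : lah (S j) m b = Cmult (RtoC (INR (S j) * INR (fact j) / INR (fact m)))
       (Cdiv (Cmult (Cminus (RtoC (INR m)) b) r) (RtoC (INR (S i))))).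
    { unfold lah; destruct (Nat.leb_spec m (S j)); [| lia].
      replace (S j - m)%nat with (S i) by (unfold i; lia).
      unfold r; rewrite <- rho_raise, fact_simpl, mult_INR; field; apply INR_S_neq0. }
    assert (E2 : lah j m (Cminus b (RtoC 1)) = Cmult (RtoC (INR (fact j) / INR (fact m))) r).
    { unfold lah; destruct (Nat.leb_spec m j); [| lia].
      unfold r; do 2 f_equal; ring. }
    assert (E3 : Cshift (fun m => lah j m (Cminus b (RtoC 2))) m =
      Cmult (RtoC (INR m * INR (fact j) / INR (fact m)))
       (Cdiv (Cmult r (Cplus (Cplus (Cminus (RtoC (INR m)) b) (RtoC 1)) (RtoC (INR i))))
          (RtoC (INR (S i))))).
    { destruct m as [| m]; cbn [Cshift].
      - simpl (INR 0); unfold Rdiv; rewrite !Rmult_0_l; ring.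
      - unfold lah; destruct (Nat.leb_spec m j); [| lia].
        replace (j - m)%nat with (S i) by (unfold i; lia).
        assert (P := INR_S_pos m); assert (P' := INR_fact_pos m).
        replace (INR (S m) * INR (fact j) / INR (fact (S m))) with (INR (fact j) / INR (fact m))
          by (rewrite fact_simpl, mult_INR; field; lra).
        unfold r; rewrite <- rho_S.
        replace (Cplus (Cminus (RtoC (INR (S m))) b) (RtoC 1)) with (Cminus (RtoC (INR m)) (Cminus b (RtoC 2)))
          by (rewrite S_INR, RtoC_plus; ring).
        field; apply INR_S_neq0. }
    rewrite E1, E2, E3.
    assert (P' := INR_fact_pos m).
    rewrite Ej at 1; rewrite S_INR, plus_INR.
    rewrite !RtoC_div, !RtoC_mult, !RtoC_plus by lra.
    assert (N := INR_S_neq0 i); rewrite S_INR, RtoC_plus in *.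
    field; split; auto; apply RtoC_neq0; lra.
  - unfold lah at 2; destruct (Nat.leb_spec m j); [lia |].
    destruct m as [| m]; [lia |]; cbn [Cshift]; unfold lah.
    destruct (Nat.leb_spec m j) as [L' | L'], (Nat.leb_spec (S m) (S j)); try lia.
    + replace m with j by lia; rewrite !Nat.sub_diag; cbn [rho].
      unfold Rdiv; rewrite !Rinv_r by (apply Rgt_not_eq, INR_fact_pos); ring.
    + ring.
Qed.

Lemma Phi_n_0 (a : C) (x : R) (j : nat) (b : C) (k : nat) :
  Phi_n a x j b k 0 =
  Csum (fun m => Cmult (lah j m b) (Cmult (RtoC ((x / 2) ^ (m + k))) (eta a (m + k)))) (S j).
Proof.
  revert b k; induction j; intros b k.
  - simpl; unfold Phi, lah; rewrite Rminus_0_r, Cpow_pos_1.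
    replace (0 * x / (2 * 1)) with 0 by field.
    rewrite decay_0; simpl; replace (1 / 1) with 1 by field; unfold eta; ring.
  - cbn [Phi_n]; rewrite !IHj.
    rewrite (Csum_ext _ (fun m => Cplus
      (Cmult (Copp b) (Cmult (lah j m (Cminus b (RtoC 1)))
         (Cmult (RtoC ((x / 2) ^ (m + k))) (eta a (m + k)))))
      (Cmult (Cshift (fun m => lah j m (Cminus b (RtoC 2))) m)
         (Cmult (RtoC ((x / 2) ^ (m + k))) (eta a (m + k))))) (S (S j)))
      by (intros; rewrite lah_S; ring).
    rewrite Csum_plus; f_equal.
    + rewrite Csum_scal; f_equal; symmetry; apply Csum_tail; [lia |].
      intros m Hm; unfold lah; destruct (Nat.leb_spec m j); [lia | ring].
    + rewrite (Csum_S_left _ (S j)); cbn [Cshift]; rewrite Cmult_0_l, Cplus_0_l.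
      apply Csum_ext; intros m _; replace (m + S k)%nat with (S m + k)%nat by lia; reflexivity.
Qed.

Local Open Scope C_scope.

(** * Cauchy products with binomial series *)

(** The coefficient of [t^j] in [A(t) (1-t)^(-b)]. *)
Definition conv (A : nat -> C) (b : C) (j : nat) : C :=
  Csum (fun m => A m * rho b (j - m)) (S j).

Lemma conv_ext (A B : nat -> C) (b : C) (j : nat) :
  (forall m, A m = B m) -> conv A b j = conv B b j.
Proof. intros H; apply Csum_ext; intros; rewrite H; auto. Qed.

Lemma conv_lin (c d : C) (A B : nat -> C) (b : C) (j : nat) :
  conv (fun m => c * A m + d * B m) b j = c * conv A b j + d * conv B b j.
Proof.
  unfold conv; rewrite <- !Csum_scal, <- Csum_plus; apply Csum_ext; intros; ring.
Qed.

Lemma conv_Cshift (A : nat -> C) (b : C) (j : nat) :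
  conv (Cshift A) b j = Csum (fun m => A m * Cshift (rho b) (j - m)) (S j).
Proof.
  unfold conv; rewrite Csum_S_left; cbn [Csum Cshift]; rewrite Nat.sub_diag; cbn [Cshift].
  rewrite Cmult_0_l, Cmult_0_r, Cplus_0_l, Cplus_0_r.
  apply Csum_ext; intros m Hm; replace (j - m)%nat with (S (j - S m)) by lia; reflexivity.
Qed.

Definition diff1 (A : nat -> C) (m : nat) : C := A m - Cshift A m.

(** A factor [1 - t] is moved from the binomial series into [A], which brings terms with different
    exponents to a common one. *)
Lemma conv_raise (A : nat -> C) (b : C) (j : nat) :
  conv A b j = conv (diff1 A) (b + 1) j.
Proof.
  transitivity (1 * conv A (b + 1) j + -1 * conv (Cshift A) (b + 1) j).
  - rewrite conv_Cshift; unfold conv; rewrite <- !Csum_scal, <- Csum_plus.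
    apply Csum_ext; intros; rewrite (rho_diff b); ring.
  - rewrite <- conv_lin; apply conv_ext; intros; unfold diff1; ring.
Qed.

(* The coefficients of [t d/dt] applied to [A(t) (1-t)^(-b)], relative to [(1-t)^(-b-1)]. *)
Definition eulerop (b : C) (A : nat -> C) (m : nat) : C :=
  diff1 (fun m => INR m * A m) m + b * Cshift A m.

Lemma conv_eulerop (A : nat -> C) (b : C) (j : nat) :
  INR j * conv A b j = conv (eulerop b A) (b + 1) j.
Proof.
  transitivity (1 * conv (diff1 (fun m => INR m * A m)) (b + 1) j + b * conv (Cshift A) (b + 1) j).
  - rewrite <- conv_raise, conv_Cshift; unfold conv.
    rewrite <- !Csum_scal, <- Csum_plus; apply Csum_ext; intros m Hm.
    assert (E : INR (j - m) * rho b (j - m) = b * Cshift (rho (b + 1)) (j - m)).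
    { destruct (j - m)%nat; cbn [Cshift]; [simpl INR; ring | apply rho_raise]. }
    replace (INR j : C) with (INR m + INR (j - m))
      by (rewrite <- RtoC_plus, <- plus_INR; do 2 f_equal; lia).
    transitivity (INR m * A m * rho b (j - m) + A m * (INR (j - m) * rho b (j - m))); [ring |].
    rewrite E; ring.
  - rewrite <- conv_lin; apply conv_ext; intros; unfold eulerop; ring.
Qed.

(** * The coefficient form of the differential equation *)

(** The operator [P] sends [x^n] to [palpha n x^(n-2) - pbeta n x^(n-1) + pgamma n x^n]. *)
Definition palpha (mu l n : C) : C := n * (n - 2 * l - 1) * (n + mu) * (n + mu - 2 * l - 1).
Definition pbeta (mu l n : C) : C :=
  n * (n - 2 * l - 1) * (n + mu - l) + (n - l) * (n + 1 + mu) * (n + mu - 2 * l).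
Definition pgamma (mu l n : C) : C := (n - l) * (n + 1 + mu - l).

(* The four hypotheses are the two-term recursions of the factors [h] and [p]; the conclusion
   is the coefficient of [t^j] in the partial differential equation for the generating function,
   and lies in the ideal they generate. *)
Lemma hypergeometric_bracket (mu l m n h0 h1 h2 p0 p1 p2 : C) :
  m * (m + mu) * h0 = - (2 * m - 1 + mu) * h1 ->
  (m - 1) * (m - 1 + mu) * h1 = - (2 * m - 3 + mu) * h2 ->
  n * (n - 1 - 2 * l) * p0 = 2 * (n - 1 - l) * p1 ->
  (n - 1) * (n - 2 - 2 * l) * p1 = 2 * (n - 2 - l) * p2 ->
  let K := m + n in
  let s := K - 2 - l in
  let E := s + (mu + 1) / 2 in
  let f := fun m => m * (m + mu + 1) in
  palpha mu l K / 4 * (h0 * p0) - pbeta mu l (K - 1) / 2 * (h0 * p1 - h1 * p0)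
  + pgamma mu l (K - 2) * (h0 * p2 - 2 * (h1 * p1) + h2 * p0)
  = f m * (h0 * p2) + (- 2 * f (m - 1) + (2 * (m - 1) + mu + 2) * E) * (h1 * p1)
  + (f (m - 2) - (2 * (m - 2) + mu + 2) * E + E * (E + 1)) * (h2 * p0).
Proof.
  intros H1 H2 H3 H4 K s E f.
  assert (Z : forall u v : C, u = v -> u - v = 0) by (intros u v ->; ring).
  apply Z in H1; apply Z in H2; apply Z in H3; apply Z in H4.
  match goal with |- ?L = ?R => enough (D : L - R = 0) by
    (transitivity ((L - R) + R); [ring | rewrite D; ring]) end.
  match type of H1 with ?e1 = _ => match type of H2 with ?e2 = _ =>
  match type of H3 with ?e3 = _ => match type of H4 with ?e4 = _ =>
  (* Explicit cofactors of the four relations, checked as a polynomial identity by [field]. *)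
  transitivity (
    e1 * (p0 * ((1/4) + l + l*l + (-1/4)*mu + (-1/2)*mu*l + (-3/2)*n + (-3)*n*l + (1/2)*n*mu
            + (3/2)*n*n + (-1/2)*m + (-1)*m*l + (1/4)*m*mu + m*n + (1/4)*m*m)
        + p1 * (3 + 3*l + (-1/2)*mu + (-3)*n + (-1)*m))
    + e2 * (p0 * ((2*s - m + 2 + (mu+1)/2)/2))
    + e3 * (h0 * ((-1/4)*mu + (-1/2)*mu*l + (1/4)*mu*mu + (-1/4)*n + (-1/2)*n*l + (1/2)*n*mu
            + (1/4)*n*n + (-1/2)*m + (-1)*m*l + m*n)
        + h1 * ((-1/2) + (-1)*l + n))
    + e4 * (h0 * (-(s + m + 1 + mu)/2)))
  end end end end.
  - unfold f, E, s, K, palpha, pbeta, pgamma; field.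
  - rewrite H1, H2, H3, H4; ring.
Qed.

(** The integer index keeps [z - m] and [z - 2] from truncating at 0, so the recursion holds without
    boundary cases. *)
Definition pZ (l : nat) (z : Z) : C :=
  if (z <? 0)%Z then 0 else RtoC (pcoef l (Z.to_nat z)).

Lemma pZ_neg (l : nat) (z : Z) : (z < 0)%Z -> pZ l z = 0.
Proof. intros H; unfold pZ; destruct (Z.ltb_spec z 0); [auto | lia]. Qed.

Lemma pZ_nat (l n : nat) : pZ l (Z.of_nat n) = pcoef l n.
Proof.
  unfold pZ; destruct (Z.ltb_spec (Z.of_nat n) 0); [lia | rewrite Nat2Z.id; auto].
Qed.

Lemma pZ_rec (l : nat) (z : Z) :
  IZR z * (IZR z - 1 - 2 * INR l) * pZ l z = 2 * (IZR z - 1 - INR l) * pZ l (z - 1).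
Proof.
  destruct (Z.lt_trichotomy z 0) as [H | [-> | H]].
  - rewrite !pZ_neg by lia; ring.
  - rewrite (pZ_neg l (0 - 1)) by lia; ring.
  - replace z with (Z.of_nat (S (Z.to_nat (z - 1)))) by lia.
    set (n := Z.to_nat (z - 1)).
    replace (Z.of_nat (S n) - 1)%Z with (Z.of_nat n) by lia.
    rewrite !pZ_nat, <- INR_IZR_INZ.
    assert (H0 := f_equal RtoC (pcoef_rec l n)).
    rewrite !S_INR, !RtoC_mult, !RtoC_minus, !RtoC_mult, !RtoC_plus in *.
    etransitivity; [etransitivity; [| exact H0] |]; ring.
Qed.

Definition eta_fact (a : C) (m : nat) : C := eta a m / INR (fact m).

Lemma fact_neq0 (m : nat) : RtoC (INR (fact m)) <> 0.
Proof. apply RtoC_neq0, Rgt_not_eq, INR_fact_pos. Qed.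

Lemma eta_fact_rec (mu : C) (m : nat) :
  INR (S m) * (INR (S m) + mu) * eta_fact (mu / 2) (S m) =
  - (2 * INR (S m) - 1 + mu) * eta_fact (mu / 2) m.
Proof.
  assert (H := eta_rec (mu / 2) m).
  unfold eta_fact; rewrite fact_simpl, mult_INR, RtoC_mult.
  assert (N := fact_neq0 m); assert (N' := INR_S_neq0 m).
  rewrite !S_INR, !RtoC_plus, !RtoC_mult in *.
  set (M := RtoC (INR m)) in *; set (e1 := eta _ (S m)) in *; set (e0 := eta _ m) in *.
  set (F := RtoC (INR (fact m))) in *.
  assert (H' : (M + 1 + mu) * e1 = - ((2 * M + 1 + mu) * e0)).
  { transitivity ((M + 1 + 2 * (mu / 2)) * e1 + (2 * M + 1 + 2 * (mu / 2)) * e0 - (2 * M + 1 + mu) * e0).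
    - field.
    - rewrite H; ring. }
  transitivity ((M + 1 + mu) * e1 / F); [field; auto |].
  rewrite H'; field; auto.
Qed.

(* The coefficient of [t^j (x/2)^z] in the generating function, up to a constant. *)
Definition Ucoef (mu : C) (l j : nat) (z : Z) : C :=
  conv (fun m => eta_fact (mu / 2) m * pZ l (z - Z.of_nat m))
       (IZR z - (INR l - (mu + 1) / 2)) j.

Lemma Ucoef_ode (mu : C) (l j : nat) (K : Z) :
  palpha mu (INR l) (IZR K) / 4 * Ucoef mu l j K
  - pbeta mu (INR l) (IZR (K - 1)) / 2 * Ucoef mu l j (K - 1)
  + pgamma mu (INR l) (IZR (K - 2)) * Ucoef mu l j (K - 2)
  = INR j * (INR j + (mu + 1)) * Ucoef mu l j (K - 2).
Proof.
  unfold Ucoef.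
  set (h := eta_fact (mu / 2)).
  set (A0 := fun m => h m * pZ l (K - Z.of_nat m)).
  set (A1 := fun m => h m * pZ l (K - 1 - Z.of_nat m)).
  set (A2 := fun m => h m * pZ l (K - 2 - Z.of_nat m)).
  set (c := INR l - (mu + 1) / 2).
  set (b := IZR (K - 2) - c).
  replace (IZR K - c) with (b + 1 + 1) by (unfold b; rewrite minus_IZR, RtoC_minus; ring).
  replace (IZR (K - 1) - c) with (b + 1) by (unfold b; rewrite !minus_IZR, !RtoC_minus; ring).
  rewrite (conv_raise A1 (b + 1)).
  (* The three powers of [x] carry the exponents [b+2], [b+1] and [b]. In [j^2 + (mu+1) j] each
     factor [j] is an Euler operator, which raises the exponent by one; the linear term is raised
     once more by [diff1]. *)
  replace (INR j * (INR j + (mu + 1)) * conv A2 b j) with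
    (1 * conv (eulerop (b + 1) (eulerop b A2)) (b + 1 + 1) j
     + (mu + 1) * conv (diff1 (eulerop b A2)) (b + 1 + 1) j)
    by (rewrite <- conv_eulerop, <- conv_raise, <- conv_eulerop; ring).
  rewrite (conv_raise A2 b), (conv_raise (diff1 A2) (b + 1)), <- conv_lin.
  match goal with |- ?a * ?u - ?b * ?v + ?d * ?w = _ =>
    transitivity (1 * (a * u + (- b) * v) + d * w); [ring |] end.
  rewrite <- conv_lin, <- conv_lin; apply conv_ext; intros m.
  assert (P0 := pZ_rec l (K - Z.of_nat m)).
  assert (P1 := pZ_rec l (K - 1 - Z.of_nat m)).
  replace (K - 1 - Z.of_nat m - 1)%Z with (K - 2 - Z.of_nat m)%Z in P1 by lia.
  replace (K - Z.of_nat m - 1)%Z with (K - 1 - Z.of_nat m)%Z in P0 by lia.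
  (* [h1] and [h2] stand for [h (m-1)] and [h (m-2)]. Where these do not exist they are taken to be
     0, and the recursions survive because of the factors [m] and [m - 1]. *)
  assert (H : forall h1 h2 : C,
    INR m * (INR m + mu) * h m = - (2 * INR m - 1 + mu) * h1 ->
    (INR m - 1) * (INR m - 1 + mu) * h1 = - (2 * INR m - 3 + mu) * h2 ->
    _) by (intros h1 h2 E1 E2;
      refine (hypergeometric_bracket mu (INR l) (INR m) (IZR (K - Z.of_nat m)) (h m) h1 h2
        (pZ l (K - Z.of_nat m)) (pZ l (K - 1 - Z.of_nat m)) (pZ l (K - 2 - Z.of_nat m)) E1 E2 P0 _);
      etransitivity; [etransitivity; [| exact P1] |]; rewrite !minus_IZR, !RtoC_minus; ring).
  cbv zeta in H.
  replace (INR m + IZR (K - Z.of_nat m)) with (RtoC (IZR K)) in H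
    by (rewrite minus_IZR, RtoC_minus, <- INR_IZR_INZ; ring).
  unfold b, c; rewrite !minus_IZR, !RtoC_minus; clear P0 P1.
  destruct m as [| [| m]].
  - specialize (H 0 0); unfold diff1, eulerop, diff1; cbn [Cshift].
    assert (H' := H ltac:(simpl INR; ring) ltac:(ring)); clear H.
    unfold A0, A1, A2 in *; simpl (INR 0) in *.
    etransitivity; [etransitivity; [| exact H'] |]; field.
  - specialize (H (h O) 0); unfold diff1, eulerop, diff1; cbn [Cshift].
    assert (H' := H (eta_fact_rec mu 0) ltac:(simpl INR; ring)); clear H.
    replace (A1 O) with (h O * pZ l (K - Z.of_nat 1)) by (unfold A1; do 2 f_equal; lia).
    replace (A2 O) with (h O * pZ l (K - 1 - Z.of_nat 1)) by (unfold A2; do 2 f_equal; lia).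
    unfold A0, A1, A2; simpl (INR 1) in *; simpl (INR 0).
    etransitivity; [etransitivity; [| exact H'] |]; field.
  - specialize (H (h (S m)) (h m)); unfold diff1, eulerop, diff1; cbn [Cshift].
    assert (E2 := eta_fact_rec mu m); assert (E1 := eta_fact_rec mu (S m)).
    fold h in E1, E2.
    replace (A1 (S m)) with (h (S m) * pZ l (K - Z.of_nat (S (S m))))
      by (unfold A1; do 2 f_equal; lia).
    replace (A2 (S m)) with (h (S m) * pZ l (K - 1 - Z.of_nat (S (S m))))
      by (unfold A2; do 2 f_equal; lia).
    replace (A2 m) with (h m * pZ l (K - Z.of_nat (S (S m))))
      by (unfold A2; do 2 f_equal; lia).
    unfold A0, A1, A2.
    rewrite !S_INR, !RtoC_plus in *.
    assert (H' := H E1 ltac:(etransitivity; [etransitivity; [| exact E2] |]; ring)); clear H E1 E2.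
    etransitivity; [etransitivity; [| exact H'] |]; field.
Qed.

(** * Polynomials in [x] *)

Definition Peval (a : nat -> C) (D : nat) (x : R) : C := Csum (fun n => a n * RtoC (x ^ n)) D.

Lemma Peval_ext (a b : nat -> C) (D : nat) (x : R) :
  (forall n, (n < D)%nat -> a n = b n) -> Peval a D x = Peval b D x.
Proof. intros H; apply Csum_ext; intros n Hn; rewrite H; auto. Qed.

Lemma Peval_tail (a : nat -> C) (D D' : nat) (x : R) : (D <= D')%nat ->
  (forall n, (D <= n)%nat -> a n = 0) -> Peval a D' x = Peval a D x.
Proof.
  intros L H; apply Csum_tail; auto; intros n Hn; rewrite H by lia; ring.
Qed.

Lemma Peval_scal (c : C) (a : nat -> C) (D : nat) (x : R) :
  Peval (fun n => c * a n) D x = c * Peval a D x.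
Proof. unfold Peval; rewrite <- Csum_scal; apply Csum_ext; intros; ring. Qed.

Lemma Peval_plus (a b : nat -> C) (D : nat) (x : R) :
  Peval (fun n => a n + b n) D x = Peval a D x + Peval b D x.
Proof. unfold Peval; rewrite <- Csum_plus; apply Csum_ext; intros; ring. Qed.

Lemma Peval_Cshift (a : nat -> C) (D : nat) (x : R) :
  Peval (Cshift a) (S D) x = RtoC x * Peval a D x.
Proof.
  unfold Peval; rewrite Csum_S_left, <- Csum_scal; cbn [Cshift].
  rewrite Cmult_0_l, Cplus_0_l; apply Csum_ext; intros n _.
  rewrite <- tech_pow_Rmult, RtoC_mult; ring.
Qed.

Lemma Peval_S_left (a : nat -> C) (D : nat) (x : R) :
  Peval a (S D) x = a O + RtoC x * Peval (fun n => a (S n)) D x.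
Proof.
  unfold Peval; rewrite Csum_S_left, <- Csum_scal; simpl (x ^ 0); rewrite Cmult_1_r; f_equal.
  apply Csum_ext; intros n _; rewrite <- tech_pow_Rmult, RtoC_mult; ring.
Qed.

Lemma Cpoly_eval_Peval (cs : list C) (x : R) :
  Cpoly_eval cs x = Peval (fun n => nth n cs 0) (length cs) x.
Proof.
  induction cs as [| c cs IH]; [reflexivity |].
  cbn [length]; rewrite Peval_S_left; cbn [nth]; rewrite <- IH; reflexivity.
Qed.

Lemma Peval_Cpoly_eval (a : nat -> C) (D : nat) :
  exists cs, forall x, Peval a D x = Cpoly_eval cs x.
Proof.
  revert a; induction D; intros a.
  - exists nil; reflexivity.
  - destruct (IHD (fun n => a (S n))) as [cs H]; exists (a O :: cs); intros x.
    rewrite Peval_S_left, H; reflexivity.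
Qed.

Lemma theta_Peval (a : nat -> C) (D : nat) (x : R) :
  theta (Peval a D) x = Peval (fun n => RtoC (INR n) * a n) D x.
Proof.
  unfold theta.
  assert (H : is_Cder (Peval a D) x (Csum (fun n => a n * RtoC (INR n * x ^ pred n)) D)).
  { apply (is_Cder_Csum (fun n y => a n * RtoC (y ^ n))); intros n.
    apply is_Cder_scal, is_Cder_RtoC.
    replace (INR n * x ^ pred n)%R with (INR n * 1 * x ^ pred n)%R by ring.
    apply (is_derive_pow (fun y => y)); apply (is_derive_id (K := R_AbsRing)). }
  rewrite (is_Cder_CDerive _ _ _ H), <- Csum_scal; apply Csum_ext; intros n _.
  destruct n; [simpl INR; rewrite Rmult_0_l; ring |].
  cbn [pred]; rewrite <- tech_pow_Rmult, !RtoC_mult; ring.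
Qed.

Lemma Lfac_Peval (b : C) (a : nat -> C) (D : nat) (x : R) :
  (forall n, (D <= n)%nat -> a n = 0) ->
  Lfac b (Peval a D) x =
  Peval (fun n => (RtoC (INR n) + b) * a n - / 2 * Cshift a n) (S D) x.
Proof.
  intros H; unfold Lfac; rewrite theta_Peval; symmetry.
  rewrite (Peval_ext _ (fun n => ((RtoC (INR n) * a n) + b * a n) + (- / 2) * Cshift a n))
    by (intros; ring).
  rewrite !Peval_plus, !Peval_scal, Peval_Cshift.
  rewrite (Peval_tail (fun n => RtoC (INR n) * a n) D), (Peval_tail a D);
    try lia; auto; [| intros; rewrite H by auto; ring].
  rewrite RtoC_div by lra; field.
Qed.

(** The [x^2/4] produced by the two first-order factors cancels against the subtracted [(x/2)^2];
    hence only one shift occurs and [Lop] raises the degree by at most one. *)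
Definition Lop_coef (b1 b2 : C) (a : nat -> C) (n : nat) : C :=
  (RtoC (INR n) + b1) * (RtoC (INR n) + b2) * a n
  - / 2 * ((2 * RtoC (INR n) - 1 + b1 + b2) * Cshift a n).

(** [M] is identified with its polynomial only for [x > 0]; since the half-line is open, such an
    equality passes through derivatives. *)
Lemma Lfac_ext_pos (b : C) (f g : R -> C) :
  (forall x : R, (0 < x)%R -> f x = g x) -> forall x : R, (0 < x)%R -> Lfac b f x = Lfac b g x.
Proof.
  intros H x Hx; unfold Lfac, theta.
  rewrite (CDerive_ext_loc f g), H; auto.
  apply locally_open with (D := fun y => (0 < y)%R); auto; apply open_gt.
Qed.

Lemma Lop_ext_pos (b1 b2 : C) (f g : R -> C) :
  (forall x : R, (0 < x)%R -> f x = g x) -> forall x : R, (0 < x)%R -> Lop b1 b2 f x = Lop b1 b2 g x.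
Proof.
  intros H x Hx; unfold Lop; rewrite H by auto; f_equal.
  apply Lfac_ext_pos; auto; intros y Hy; apply Lfac_ext_pos; auto.
Qed.

Lemma Pop_ext_pos (mu : C) (l : nat) (f g : R -> C) :
  (forall x : R, (0 < x)%R -> f x = g x) -> forall x : R, (0 < x)%R -> Pop mu l f x = Pop mu l g x.
Proof.
  intros H x Hx; unfold Pop; f_equal; apply Lop_ext_pos; auto.
  intros y Hy; apply Lop_ext_pos; auto.
Qed.

Lemma Lop_coef_tail (b1 b2 : C) (a : nat -> C) (D : nat) :
  (forall n, (D <= n)%nat -> a n = 0) -> forall n, (S D <= n)%nat -> Lop_coef b1 b2 a n = 0.
Proof.
  intros H [| n] Hn; [lia |]; unfold Lop_coef; cbn [Cshift]; rewrite !H by lia; ring.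
Qed.

Lemma Lop_Peval (b1 b2 : C) (a : nat -> C) (D : nat) (x : R) :
  (forall n, (D <= n)%nat -> a n = 0) -> (0 < x)%R ->
  Lop b1 b2 (Peval a D) x = Peval (Lop_coef b1 b2 a) (S D) x.
Proof.
  intros H Hx; unfold Lop.
  rewrite (Lfac_ext_pos b1 _ _ (fun y _ => Lfac_Peval b2 a D y H)) by auto.
  rewrite Lfac_Peval.
  2:{ intros [| n] Hn; [lia |]; cbn [Cshift]; rewrite !H by lia; ring. }
  rewrite <- (Peval_tail (Lop_coef b1 b2 a) (S D) (S (S D)))
    by (try lia; apply Lop_coef_tail; auto).
  replace (RtoC ((x / 2) ^ 2) * Peval a D x) with
    (Peval (fun n => / 4 * Cshift (Cshift a) n) (S (S D)) x).
  2:{ rewrite Peval_scal, !Peval_Cshift.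
      replace ((x / 2) ^ 2)%R with (/ 4 * (x * x))%R by field.
      rewrite !RtoC_mult, RtoC_inv by lra; ring. }
  match goal with |- ?u - ?v = _ => transitivity (u + (-1) * v); [ring |] end.
  rewrite <- Peval_scal, <- Peval_plus; apply Peval_ext; intros n _.
  unfold Lop_coef; destruct n as [| [| n]]; cbn [Cshift].
  - field.
  - simpl INR; field.
  - rewrite (S_INR (S n)), RtoC_plus; field.
Qed.

Definition Pop_coef (mu : C) (l : nat) (a : nat -> C) : nat -> C :=
  Lop_coef (mu - RtoC (2 * INR l + 1)) mu (Lop_coef (RtoC (- (2 * INR l + 1))) 0 a).

Lemma Pop_Peval (mu : C) (l : nat) (a : nat -> C) (D : nat) (x : R) :
  (forall n, (D <= n)%nat -> a n = 0) -> (0 < x)%R ->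
  Pop mu l (Peval a D) x = RtoC (/ x ^ 2) * Peval (Pop_coef mu l a) (S (S D)) x.
Proof.
  intros H Hx; unfold Pop; f_equal.
  rewrite (Lop_ext_pos _ _ _ _ (fun y Hy => Lop_Peval (RtoC (- (2 * INR l + 1))) 0 a D y H Hy)) by auto.
  apply Lop_Peval; auto; apply Lop_coef_tail; auto.
Qed.

Lemma Pop_coef_S_S (mu : C) (l : nat) (a : nat -> C) (n : nat) :
  Pop_coef mu l a (S (S n)) =
  palpha mu (RtoC (INR l)) (RtoC (INR n) + 2) * a (S (S n))
  - pbeta mu (RtoC (INR l)) (RtoC (INR n) + 1) * a (S n)
  + pgamma mu (RtoC (INR l)) (RtoC (INR n)) * a n.
Proof.
  unfold Pop_coef, Lop_coef, palpha, pbeta, pgamma; cbn [Cshift].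
  rewrite !S_INR, RtoC_opp, !RtoC_plus, !RtoC_mult; field.
Qed.

Lemma Pop_coef_1 (mu : C) (l : nat) (a : nat -> C) :
  Pop_coef mu l a 1%nat =
  palpha mu (RtoC (INR l)) 1 * a 1%nat - pbeta mu (RtoC (INR l)) 0 * a O.
Proof.
  unfold Pop_coef, Lop_coef, palpha, pbeta; cbn [Cshift]; simpl (INR 1); simpl (INR 0).
  rewrite RtoC_opp, !RtoC_plus, !RtoC_mult; field.
Qed.

Lemma Pop_coef_0 (mu : C) (l : nat) (a : nat -> C) :
  Pop_coef mu l a O = palpha mu (RtoC (INR l)) 0 * a O.
Proof.
  unfold Pop_coef, Lop_coef, palpha; cbn [Cshift]; simpl (INR 0).
  rewrite RtoC_opp, !RtoC_plus, !RtoC_mult; field.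
Qed.

Lemma Peval_bounded (a : nat -> C) (D : nat) : exists B : R, (0 <= B)%R /\
  forall x : R, (0 < x < 1)%R -> (Cmod (Peval a D x) <= B)%R.
Proof.
  induction D as [| D [B [HB H]]].
  - exists 0%R; split; [lra |]; intros; unfold Peval; simpl; rewrite Cmod_0; lra.
  - exists (B + Cmod (a D))%R; split; [generalize (Cmod_ge_0 (a D)); lra |].
    intros x Hx; unfold Peval; cbn [Csum].
    eapply Rle_trans; [apply Cmod_triangle |]; apply Rplus_le_compat; [apply H; auto |].
    rewrite Cmod_mult, Cmod_R, Rabs_pos_eq by (apply pow_le; lra).
    rewrite <- Rmult_1_r; apply Rmult_le_compat_l; [apply Cmod_ge_0 |].
    rewrite <- (pow1 D); apply pow_incr; lra.
Qed.

Lemma Peval_eq0 (a : nat -> C) (D : nat) :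
  (forall x : R, (0 < x)%R -> Peval a D x = 0) -> forall n, (n < D)%nat -> a n = 0.
Proof.
  revert a; induction D; intros a H n Hn; [lia |].
  assert (A0 : a O = 0).
  { destruct (Peval_bounded (fun n => a (S n)) D) as [B [HB Hb]].
    apply Cmod_eq_0, Rle_antisym; [| apply Cmod_ge_0].
    apply Rnot_lt_le; intros P.
    (* Small enough that [x * B < Cmod (a O)], although the vanishing sum forces
       [Cmod (a O) <= x * B]. The point 0 itself is excluded by the hypothesis. *)
    set (x := (Rmin (1 / 2) (Cmod (a O) / (2 * (B + 1))))%R).
    assert (X : (0 < x < 1)%R).
    { split.
      - apply Rmin_glb_lt; [lra | apply Rdiv_lt_0_compat; lra].
      - eapply Rle_lt_trans; [apply Rmin_l | lra]. }
    assert (X2 : (x * (2 * (B + 1)) <= Cmod (a O))%R).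
    { apply Rle_div_r; [lra | apply Rmin_r]. }
    assert (E := H x (proj1 X)); rewrite Peval_S_left in E.
    assert (E' : a O = - (RtoC x * Peval (fun n => a (S n)) D x)).
    { transitivity (a O + RtoC x * Peval (fun n => a (S n)) D x
        - RtoC x * Peval (fun n => a (S n)) D x); [ring | rewrite E; ring]. }
    assert (M : (Cmod (a O) <= x * B)%R).
    { rewrite E', Cmod_opp, Cmod_mult, Cmod_R, Rabs_pos_eq by lra.
      apply Rmult_le_compat_l; [lra | apply Hb; auto]. }
    nra. }
  destruct n as [| n]; auto.
  apply (IHD (fun n => a (S n))); [| lia].
  intros x Hx; assert (E := H x Hx); rewrite Peval_S_left, A0, Cplus_0_l in E.
  apply (Cmult_integral_r _ _ E), RtoC_neq0; lra.
Qed.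

(** [Pop_coef mu l a n] is the coefficient of [x^(n-2)] in [P u], so the indices 0 and 1 say that
    the negative powers of [x] cancel. *)
Lemma Pop_eigen_iff (mu : C) (l : nat) (lam : C) (a : nat -> C) (D : nat) :
  (forall n, (D <= n)%nat -> a n = 0) ->
  (forall x : R, (0 < x)%R -> Pop mu l (Peval a D) x = lam * Peval a D x) <->
  (forall n, Pop_coef mu l a n = lam * Cshift (Cshift a) n).
Proof.
  intros H; split.
  - intros E n.
    destruct (Nat.le_gt_cases (S (S D)) n) as [L | L].
    + unfold Pop_coef; rewrite (Lop_coef_tail _ _ _ (S D)) by (try lia; apply Lop_coef_tail; auto).
      destruct n as [| [| n]]; try lia; cbn [Cshift]; rewrite H by lia; ring.
    + assert (Z : Pop_coef mu l a n + - lam * Cshift (Cshift a) n = 0).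
      { apply (Peval_eq0 (fun n => Pop_coef mu l a n + - lam * Cshift (Cshift a) n) (S (S D))); auto.
        intros x Hx; rewrite Peval_plus, Peval_scal, !Peval_Cshift.
        assert (E' := E x Hx); rewrite Pop_Peval in E' by auto.
        rewrite RtoC_inv in E' by (apply pow_nonzero; lra).
        assert (N : RtoC x <> 0) by (apply RtoC_neq0; lra).
        replace (RtoC (x ^ 2)) with (RtoC x * RtoC x) in E'
          by (rewrite <- RtoC_mult; f_equal; ring).
        transitivity (RtoC x * RtoC x * (/ (RtoC x * RtoC x) * Peval (Pop_coef mu l a) (S (S D)) x
          - lam * Peval a D x)); [field; auto |].
        rewrite E'; ring. }
      transitivity (Pop_coef mu l a n + - lam * Cshift (Cshift a) n + lam * Cshift (Cshift a) n);
        [ring | rewrite Z; ring].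
  - intros E x Hx; rewrite Pop_Peval by auto.
    rewrite (Peval_ext _ (fun n => lam * Cshift (Cshift a) n)) by auto.
    rewrite Peval_scal, !Peval_Cshift, RtoC_inv by (apply pow_nonzero; lra).
    assert (N : RtoC x <> 0) by (apply RtoC_neq0; lra).
    replace (RtoC (x ^ 2)) with (RtoC x * RtoC x) by (rewrite <- RtoC_mult; f_equal; ring).
    field; auto.
Qed.

(** * The polynomials [M_j] *)

(** The power of 2 comes from [x/2 = (v/2) * 2(1-t)], the other factor from [Ktilde_half]. *)
Definition Gconst (l : nat) : R := (2 ^ (2 * l + 1) * (PI / 2 * Rrgamma (/ 2)))%R.

Lemma G_Phi (mu : C) (l : nat) (t x : R) : (0 < x)%R -> (t < 1)%R ->
  G mu l t x =
  Csum (fun n => RtoC (Gconst l * pcoef l n * (x / 2) ^ n) *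
    Phi (mu / 2) x (RtoC (INR l) - (mu + 1) / 2 - RtoC (INR n)) 0 t) (S l).
Proof.
  intros Hx Ht; unfold G.
  set (v := (x / (2 * (1 - t)))%R); set (w := (t * x / (2 * (1 - t)))%R).
  assert (Hv : (0 < v)%R) by (apply Rdiv_lt_0_compat; lra).
  set (b := RtoC (INR l) - (mu + 1) / 2).
  assert (EK : ((x / 2) ^ (2 * l + 1) * exp (x / 2) * Ktilde (INR l + / 2) v)%R =
    (Gconst l * (1 - t) ^ (2 * l + 1) * exp (- w) * PSeries (pcoef l) v)%R).
  { replace (x / 2)%R with (v / 2 * (2 * (1 - t)))%R at 1 by (unfold v; field; lra).
    rewrite !Rpow_mult_distr.
    replace (exp (x / 2)) with (exp v * exp (- w))%R
      by (rewrite <- exp_plus; f_equal; unfold v, w; field; lra).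
    transitivity (2 ^ (2 * l + 1) * (1 - t) ^ (2 * l + 1) * exp v * exp (- w) *
      ((v / 2) ^ (2 * l + 1) * Ktilde (INR l + / 2) v))%R; [ring |].
    rewrite Ktilde_half by auto; unfold Gconst.
    assert (E : (exp v * exp (- v) = 1)%R) by (rewrite <- exp_plus, Rplus_opp_r; apply exp_0).
    transitivity (2 ^ (2 * l + 1) * (1 - t) ^ (2 * l + 1) * exp (- w) * (exp v * exp (- v)) *
      (PI / 2 * Rrgamma (/ 2) * PSeries (pcoef l) v))%R; [ring | rewrite E; ring]. }
  transitivity (RtoC (Gconst l) * Cpow_pos (1 - t) b * decay (icoef (mu / 2)) w *
                RtoC (PSeries (pcoef l) v)).
  - rewrite Itilde_CPSeries; unfold decay.
    (* The power [(1-t)^(2l+1)] split off from [(x/2)^(2l+1)] turns the exponent [-(l + (mu+3)/2)]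
       into [b]. *)
    replace (Cpow_pos (1 - t) b) with
      (RtoC ((1 - t) ^ (2 * l + 1)) * Cpow_pos (1 - t) (- (RtoC (INR l) + (mu + 3) / 2))).
    2:{ rewrite Cpow_pos_nat_mult by lra; f_equal; unfold b.
        rewrite plus_INR, mult_INR; simpl (INR 2); simpl (INR 1).
        rewrite !RtoC_plus, RtoC_mult, RtoC_plus; field. }
    apply (f_equal RtoC) in EK; rewrite !RtoC_mult in EK; rewrite !RtoC_mult.
    match goal with |- ?L = _ => match type of EK with ?e = _ =>
      transitivity (Cpow_pos (1 - t) (- (RtoC (INR l) + (mu + 3) / 2)) *
        CPSeries (icoef (mu / 2)) w * e) end end; [ring |].
    rewrite EK; ring.
  - rewrite (PSeries_finite (pcoef l) (S l)) by
      (first [apply entire_pcoef | intros; apply pcoef_above; lia]).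
    rewrite <- Csum_scal; apply Csum_ext; intros n _.
    unfold Phi; cbn [dcoef]; fold w; simpl ((x / 2) ^ 0)%R.
    replace ((x / 2) ^ n)%R with (v ^ n * (1 - t) ^ n)%R
      by (rewrite <- Rpow_mult_distr; f_equal; unfold v; field; lra).
    replace (Cpow_pos (1 - t) b) with
      (RtoC ((1 - t) ^ n) * Cpow_pos (1 - t) (b - RtoC (INR n)))
      by (rewrite Cpow_pos_nat_mult by lra; f_equal; ring).
    rewrite !RtoC_mult; ring.
Qed.

Lemma Csum_add (f : nat -> C) (m d : nat) :
  Csum f (m + d) = Csum f m + Csum (fun k => f (m + k)%nat) d.
Proof.
  induction d; [rewrite Nat.add_0_r; simpl; ring |].
  rewrite Nat.add_succ_r; cbn [Csum]; rewrite IHd; ring.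
Qed.

(** Reindexing by [N = m + n], the total power of [x]: the terms with [N < m] or [N > m + l]
    vanish. *)
Lemma Csum_pZ (l j m : nat) (g : nat -> C) : (m <= j)%nat ->
  Csum (fun N => pZ l (Z.of_nat N - Z.of_nat m) * g N) (S (j + l)) =
  Csum (fun n => RtoC (pcoef l n) * g (m + n)%nat) (S l).
Proof.
  intros H; replace (S (j + l)) with (m + (S l + (j - m)))%nat by lia.
  rewrite Csum_add, Csum_zero.
  2:{ intros k Hk; rewrite pZ_neg by lia; ring. }
  rewrite Cplus_0_l.
  rewrite <- (Csum_tail (fun n => RtoC (pcoef l n) * g (m + n)%nat) (S l) (S l + (j - m)));
    [| lia | intros k Hk; rewrite pcoef_above by lia; ring].
  apply Csum_ext; intros k _.
  replace (Z.of_nat (m + k) - Z.of_nat m)%Z with (Z.of_nat k) by lia; rewrite pZ_nat; auto.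
Qed.

(** The factorial turns a Taylor coefficient in [t] into a derivative, and [/ 2 ^ N] turns powers of
    [x/2] into powers of [x]. *)
Definition Mpoly_coef (mu : C) (l j N : nat) : C :=
  Mcoef mu j * RtoC (Gconst l * INR (fact j)) * (Ucoef mu l j (Z.of_nat N) * RtoC (/ 2 ^ N)).

Lemma M_Peval (mu : C) (l j : nat) (x : R) : (0 < x)%R ->
  M mu l j x = Peval (Mpoly_coef mu l j) (S (j + l)) x.
Proof.
  intros Hx; unfold M.
  rewrite (CDerive_n_Phi (mu / 2) x _
    (fun n => RtoC (Gconst l * pcoef l n * (x / 2) ^ n))
    (fun n => RtoC (INR l) - (mu + 1) / 2 - RtoC (INR n)) (S l)) by
    (first [lra | intros; apply G_Phi; auto]).
  unfold Peval, Mpoly_coef.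
  rewrite (Csum_ext _ (fun N => Mcoef mu j * RtoC (Gconst l * INR (fact j)) *
    Csum (fun m => pZ l (Z.of_nat N - Z.of_nat m) * (RtoC ((x / 2) ^ N) *
      (eta_fact (mu / 2) m *
       rho (RtoC (IZR (Z.of_nat N)) - (RtoC (INR l) - (mu + 1) / 2)) (j - m)))) (S j)) (S (j + l))).
  2:{ intros N _; unfold Ucoef, conv.
      transitivity (Mcoef mu j * RtoC (Gconst l * INR (fact j)) * (RtoC ((x / 2) ^ N) *
        Csum (fun m => eta_fact (mu / 2) m * pZ l (Z.of_nat N - Z.of_nat m) *
        rho (RtoC (IZR (Z.of_nat N)) - (RtoC (INR l) - (mu + 1) / 2)) (j - m)) (S j))).
      - unfold Rdiv; rewrite Rpow_mult_distr, pow_inv, (RtoC_mult (x ^ N)); ring.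
      - rewrite <- Csum_scal; f_equal; apply Csum_ext; intros; ring. }
  rewrite Csum_scal, Csum_swap.
  rewrite (Csum_ext _ (fun m => Csum (fun n => RtoC (pcoef l n) * (RtoC ((x / 2) ^ (m + n)) *
      (eta_fact (mu / 2) m *
       rho (RtoC (IZR (Z.of_nat (m + n))) - (RtoC (INR l) - (mu + 1) / 2)) (j - m)))) (S l)) (S j))
    by (intros m Hm; rewrite Csum_pZ by lia; reflexivity).
  rewrite Csum_swap, <- Cmult_assoc; f_equal.
  rewrite <- Csum_scal; apply Csum_ext; intros n _.
  rewrite Phi_n_0, <- !Csum_scal; apply Csum_ext; intros m Hm.
  unfold lah; destruct (Nat.leb_spec m j); [| lia].
  rewrite Nat.add_0_r, pow_add, <- INR_IZR_INZ, plus_INR.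
  replace (RtoC (INR m) - (RtoC (INR l) - (mu + 1) / 2 - RtoC (INR n))) with
    (RtoC (INR m + INR n) - (RtoC (INR l) - (mu + 1) / 2)) by (rewrite RtoC_plus; ring).
  unfold eta_fact; rewrite RtoC_div by (apply Rgt_not_eq, INR_fact_pos).
  rewrite !RtoC_mult; field; apply fact_neq0.
Qed.

Lemma Ucoef_above (mu : C) (l j N : nat) : (j + l < N)%nat -> Ucoef mu l j (Z.of_nat N) = 0.
Proof.
  intros H; apply Csum_zero; intros m Hm.
  replace (Z.of_nat N - Z.of_nat m)%Z with (Z.of_nat (N - m)) by lia.
  rewrite pZ_nat, pcoef_above by lia; ring.
Qed.

Lemma Ucoef_neg (mu : C) (l j : nat) (z : Z) : (z < 0)%Z -> Ucoef mu l j z = 0.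
Proof. intros H; apply Csum_zero; intros m Hm; rewrite pZ_neg by lia; ring. Qed.

Lemma Ucoef_top (mu : C) (l j : nat) :
  Ucoef mu l j (Z.of_nat (j + l)) = eta_fact (mu / 2) j * RtoC (/ 2 ^ l).
Proof.
  unfold Ucoef, conv; cbn [Csum]; rewrite Csum_zero.
  - replace (Z.of_nat (j + l) - Z.of_nat j)%Z with (Z.of_nat l) by lia.
    rewrite pZ_nat, pcoef_top, Nat.sub_diag; cbn [rho]; ring.
  - intros m Hm; replace (Z.of_nat (j + l) - Z.of_nat m)%Z with (Z.of_nat (j + l - m)) by lia.
    rewrite pZ_nat, pcoef_above by lia; ring.
Qed.

Lemma Mpoly_coef_above (mu : C) (l j N : nat) : (S (j + l) <= N)%nat -> Mpoly_coef mu l j N = 0.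
Proof. intros H; unfold Mpoly_coef; rewrite Ucoef_above by lia; ring. Qed.

Lemma Pop_coef_Mpoly (mu : C) (l j n : nat) :
  Pop_coef mu l (Mpoly_coef mu l j) n =
  RtoC (INR j) * (RtoC (INR j) + (mu + 1)) * Cshift (Cshift (Mpoly_coef mu l j)) n.
Proof.
  destruct n as [| [| n]]; cbn [Cshift].
  - rewrite Pop_coef_0; unfold palpha; ring.
  - rewrite Pop_coef_1; unfold Mpoly_coef.
    (* At [K = 1] the right side is a coefficient of negative index and vanishes, which is the
       cancellation of [x^(-1)]. *)
    assert (H := Ucoef_ode mu l j 1).
    rewrite (Ucoef_neg _ _ _ (1 - 2)) in H by lia.
    change (1 - 1)%Z with 0%Z in H.
    change (Z.of_nat 1) with 1%Z; change (Z.of_nat 0) with 0%Z.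
    set (U1 := Ucoef mu l j 1) in *; set (U0 := Ucoef mu l j 0) in *.
    set (k := Mcoef mu j * _).
    replace (/ 2 ^ 1)%R with (/ 2)%R by (simpl; field).
    replace (/ 2 ^ 0)%R with 1%R by (simpl; field).
    rewrite RtoC_inv by lra.
    etransitivity; [etransitivity; [| exact (f_equal (fun z => 2 * k * z) H)] |]; field.
  - rewrite Pop_coef_S_S; unfold Mpoly_coef.
    assert (H := Ucoef_ode mu l j (Z.of_nat (S (S n)))).
    replace (Z.of_nat (S (S n)) - 1)%Z with (Z.of_nat (S n)) in H by lia.
    replace (Z.of_nat (S (S n)) - 2)%Z with (Z.of_nat n) in H by lia.
    rewrite <- !INR_IZR_INZ, !S_INR, !RtoC_plus in H.
    replace (RtoC (INR n) + 1 + 1) with (RtoC (INR n) + 2) in H by ring.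
    set (U2 := Ucoef mu l j (Z.of_nat (S (S n)))) in *.
    set (U1 := Ucoef mu l j (Z.of_nat (S n))) in *; set (U0 := Ucoef mu l j (Z.of_nat n)) in *.
    set (k := Mcoef mu j * _).
    replace (/ 2 ^ S (S n))%R with (/ 2 ^ n * / 4)%R by (simpl; field; apply pow_nonzero; lra).
    replace (/ 2 ^ S n)%R with (/ 2 ^ n * / 2)%R by (simpl; field; apply pow_nonzero; lra).
    rewrite !RtoC_mult, (RtoC_inv 2), (RtoC_inv 4) by lra.
    etransitivity;
      [etransitivity; [| exact (f_equal (fun z => k * RtoC (/ 2 ^ n) * z) H)] |]; field.
Qed.

(** * Uniqueness *)

Lemma Cdiv_neq0 (u v : C) : u <> 0 -> v <> 0 -> u / v <> 0.
Proof.
  intros Hu Hv E; apply Hu; transitivity (u / v * v); [field; auto | rewrite E; ring].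
Qed.

Lemma Crgamma_neq0 (z : C) (r : R) : z = RtoC r -> (0 < r)%R -> Crgamma z <> 0.
Proof. intros -> H; rewrite Crgamma_RtoC; apply RtoC_neq0, Rrgamma_neq0; auto. Qed.

(** For [r > 0] the factor [2(m+1) - 1 + r] is nonzero, so a zero at [m+1] would propagate down to
    [1/Gamma(r/2+1)]. *)
Lemma eta_fact_neq0 (r : R) (m : nat) : (0 < r)%R -> eta_fact (RtoC r / 2) m <> 0.
Proof.
  intros Hr; induction m.
  - unfold eta_fact; apply Cdiv_neq0; [| apply fact_neq0].
    rewrite eta_0; apply Crgamma_neq0 with (r / 2 + 1)%R; [| lra].
    rewrite RtoC_plus, RtoC_div by lra; reflexivity.
  - intros E; apply IHm; assert (H := eta_fact_rec (RtoC r) m); rewrite E in H.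
    apply (Cmult_integral_r (- (2 * RtoC (INR (S m)) - 1 + RtoC r))).
    + rewrite <- H; ring.
    + rewrite <- RtoC_mult, <- RtoC_minus, <- RtoC_plus, <- RtoC_opp.
      apply RtoC_neq0; rewrite S_INR; generalize (pos_INR m); lra.
Qed.

Lemma Mcoef_neq0 (r : R) (j : nat) : (0 < r)%R -> Mcoef (RtoC r) j <> 0.
Proof.
  intros Hr; assert (P := pos_INR j); unfold Mcoef; apply Cdiv_neq0.
  - apply Crgamma_neq0 with (INR j + (r + 1) / 2)%R; [| lra].
    rewrite RtoC_plus, RtoC_div, RtoC_plus by lra; reflexivity.
  - apply Cmult_neq_0; [apply Cmult_neq_0; [apply fact_neq0 | apply Cpow_pos_neq0] |].
    apply Crgamma_neq0 with (INR j + (r + 1))%R; [| lra].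
    rewrite !RtoC_plus; reflexivity.
Qed.

Lemma Mpoly_coef_top_neq0 (r : R) (l j : nat) : (0 < r)%R ->
  Mpoly_coef (RtoC r) l j (j + l) <> 0.
Proof.
  intros Hr; unfold Mpoly_coef; rewrite Ucoef_top.
  assert (N : forall n, (/ 2 ^ n <> 0)%R) by (intros; apply Rinv_neq_0_compat, pow_nonzero; lra).
  apply Cmult_neq_0; apply Cmult_neq_0; auto using Mcoef_neq0, RtoC_neq0;
    [| apply Cmult_neq_0; auto using eta_fact_neq0, RtoC_neq0].
  assert (P := PI_RGT_0); assert (P' := Rrgamma_neq0 (/ 2) ltac:(lra)).
  apply RtoC_neq0, Rmult_integral_contrapositive_currified; [| apply Rgt_not_eq, INR_fact_pos].
  apply Rmult_integral_contrapositive_currified; [apply pow_nonzero; lra |].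
  apply Rmult_integral_contrapositive_currified; [lra | exact P'].
Qed.

(* Comparing leading coefficients, the degree [d] of a solution satisfies
   [(d-l-j)(d-l+j+r+1) = 0], hence [d = j+l]. *)
Lemma eigen_coef_zero (r : R) (l j D : nat) (a : nat -> C) :
  (2 * INR l + 1 <= r)%R ->
  (forall n, (D <= n)%nat -> a n = 0) ->
  (forall n, Pop_coef (RtoC r) l a (S (S n)) =
     RtoC (INR j) * (RtoC (INR j) + (RtoC r + 1)) * a n) ->
  a (j + l)%nat = 0 -> forall n, a n = 0.
Proof.
  intros Hr HD H H0; induction D; [intros; apply HD; lia |].
  apply IHD; intros n Hn.
  destruct (Nat.eq_dec n D) as [-> | N]; [| apply HD; lia].
  destruct (Nat.eq_dec D (j + l)) as [-> | N']; auto.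
  assert (E := H D); rewrite Pop_coef_S_S, (HD (S (S D))), (HD (S D)) in E by lia.
  apply (Cmult_integral_r (RtoC ((INR D - INR l - INR j) * (INR D - INR l + INR j + r + 1)))).
  - unfold pgamma in E.
    rewrite !RtoC_mult, !RtoC_plus, !RtoC_minus.
    match type of E with ?u = ?v => transitivity (u - v); [ring | rewrite E; ring] end.
  - apply RtoC_neq0, Rmult_integral_contrapositive_currified.
    + intros Z; apply N', INR_eq; rewrite plus_INR; lra.
    (* The bound [2l+1 <= r] makes this factor at least [l + 2]. *)
    + generalize (pos_INR D) (pos_INR l) (pos_INR j); lra.
Qed.

Local Close Scope C_scope.

Theorem theorem2p3 (mu : C) (l : nat) :
  (forall n : nat, mu <> RtoC (- INR (S n))) ->
  forall j : nat,
    (* M_j is a polynomial, and it solves P u = j (j+mu+1) u on R_+ *)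
    ((exists cs : list C, forall x : R, 0 < x -> M mu l j x = Cpoly_eval cs x) /\
     (forall x : R, 0 < x ->
        Pop mu l (M mu l j) x =
        Cmult (Cmult (RtoC (INR j)) (Cplus (RtoC (INR j)) (Cplus mu (RtoC 1))))
              (M mu l j x))) /\
    (* uniqueness of polynomial solutions up to scalars, for real mu >= 2l+1 *)
    (Im mu = 0 -> 2 * INR l + 1 <= Re mu ->
     forall cs : list C,
       (forall x : R, 0 < x ->
          Pop mu l (Cpoly_eval cs) x =
          Cmult (Cmult (RtoC (INR j)) (Cplus (RtoC (INR j)) (Cplus mu (RtoC 1))))
                (Cpoly_eval cs x)) ->
       exists c : C, forall x : R, 0 < x -> Cpoly_eval cs x = Cmult c (M mu l j x)).
Proof.
  intros _ j; split; [split |].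
  - destruct (Peval_Cpoly_eval (Mpoly_coef mu l j) (S (j + l))) as [cs H].
    exists cs; intros x Hx; rewrite M_Peval by auto; apply H.
  - intros x Hx.
    rewrite (Pop_ext_pos mu l _ _ (M_Peval mu l j)), M_Peval by auto.
    apply Pop_eigen_iff; auto using Mpoly_coef_above, Pop_coef_Mpoly.
  - intros Him Hre cs H.
    assert (Emu : mu = RtoC (Re mu)) by (apply RtoC_fst_snd; exact Him).
    set (r := Re mu) in *; clearbody r; subst mu; clear Him.
    assert (Hr : (0 < r)%R) by (generalize (pos_INR l); lra).
    set (a := fun n => nth n cs (RtoC 0)).
    assert (Ha : forall n, (length cs <= n)%nat -> a n = RtoC 0)
      by (intros; apply nth_overflow; auto).
    assert (Ea : forall x, Cpoly_eval cs x = Peval a (length cs) x)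
      by (intros; apply Cpoly_eval_Peval).
    assert (Ra := proj1 (Pop_eigen_iff (RtoC r) l
      (RtoC (INR j) * (RtoC (INR j) + (RtoC r + 1)))%C a (length cs) Ha)).
    specialize (Ra ltac:(intros x Hx; rewrite <- Ea, <- H by auto;
      apply Pop_ext_pos; auto)).
    set (p := Mpoly_coef (RtoC r) l j) in *.
    assert (Np : p (j + l)%nat <> RtoC 0) by (apply Mpoly_coef_top_neq0; auto).
    (* This multiple cancels the coefficient of [x^(j+l)], the only one that can lead a solution, so
       the difference must vanish. *)
    set (k := (a (j + l)%nat / p (j + l)%nat)%C).
    assert (Z : forall n, (a n - k * p n = 0)%C).
    { apply (eigen_coef_zero r l j (length cs + S (j + l)) (fun n => a n - k * p n)%C); auto.
      - intros n Hn; rewrite Ha by lia; unfold p; rewrite Mpoly_coef_above by lia; ring.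
      - intros n; assert (R1 := Ra (S (S n))); assert (R2 := Pop_coef_Mpoly (RtoC r) l j (S (S n))).
        fold p in R2; rewrite Pop_coef_S_S in *; cbn [Cshift] in *.
        match goal with |- _ = (?lam * _)%C =>
          transitivity (lam * a n - k * (lam * p n))%C; [| ring] end.
        rewrite <- R1, <- R2; ring.
      - unfold k; field; auto. }
    exists k; intros x Hx; rewrite Ea, M_Peval by auto; fold p.
    rewrite <- (Peval_tail a (length cs) (length cs + S (j + l))) by (auto; lia).
    rewrite <- (Peval_tail p (S (j + l)) (length cs + S (j + l)))
      by (try lia; apply Mpoly_coef_above).
    rewrite <- Peval_scal; apply Peval_ext; intros n _.
    transitivity (a n - k * p n + k * p n)%C; [ring | rewrite Z; ring].
Qed.
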